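(* Let $\Omega$ be an exponentially stable periodic orbit of $\dot x=f(x)$, $f\in C^\sigma(\mathbb R^n,\mathbb R^n)$, where $\sigma\ge2$, with basin of attraction $A(\Omega)$. Fix $x_0\in A(\Omega)$ and $c_0\in\mathbb R^+$ ($c_0>0$). Let $B\in C^{\sigma-1}(A(\Omega),\mathbb S^n)$ be such that $B(x)$ is positive definite for all $x\in A(\Omega)$, and let $C(x)=P_x^TB(x)P_x$. Then the solution $M\in C^{\sigma-1}(A(\Omega),\mathbb S^n)$ of $$LM(x)=-C(x)\ \text{ for all }x\in A(\Omega),\qquad f(x_0)^TM(x_0)f(x_0)=c_0\|f(x_0)\|^4,$$ is unique in $A(\Omega)$; that is, if $M_1,M_2\in C^{\sigma-1}(A(\Omega),\mathbb S^n)$ both satisfy these two conditions, then $M_1(x)=M_2(x)$ for all $x\in A(\Omega)$.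
   Context: $\mathbb S^n$ denotes the real symmetric $n\times n$ matrices; $\|\cdot\|$ is the Euclidean norm; $Df(x)$ is the Jacobian matrix of $f$; $S_tx$ is the solution at time $t$ of $\dot x=f(x)$ with initial value $x$ at time $0$. A periodic orbit is the orbit of a nonconstant periodic solution; $\Omega$ exponentially stable means (orbitally) exponentially stable, equivalently that all its Floquet exponents except the trivial one have negative real part. $A(\Omega)=\{x\in\mathbb R^n:\mathrm{dist}(S_tx,\Omega)\to0\text{ as }t\to\infty\}$ (an open set containing no equilibrium). For $f(x)\ne0$: $$P_x:=I-\frac{f(x)f(x)^T}{\|f(x)\|^2},$$ $$LM(x):=M'(x)+Df(x)^TM(x)+M(x)Df(x)-\frac{M(x)f(x)f(x)^T(Df(x)+Df(x)^T)}{\|f(x)\|^2}-\frac{(Df(x)+Df(x)^T)f(x)f(x)^TM(x)}{\|f(x)\|^2},$$ where $M'(x)$ is the matrix of orbital derivatives $(M'(x))_{ij}=(\nabla M_{ij}(x))^Tf(x)$. *)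

(* Defs.v *)
From HB Require Import structures.
From mathcomp Require Import all_boot all_order all_algebra.
From mathcomp Require Import all_classical all_reals all_analysis.

Set Implicit Arguments.
Unset Strict Implicit.
Unset Printing Implicit Defensive.
Import Order.TTheory GRing.Theory Num.Theory.
Import numFieldNormedType.Exports.
Local Open Scope classical_set_scope.
Local Open Scope ring_scope.

(* The library norm on matrices is the sup norm, so the Euclidean norm has to
   be defined; both induce the same topology and the same derivatives. *)
Definition enorm (R : realType) (n : nat) (v : 'cV[R]_n) : R :=
  Num.sqrt (\sum_(i < n) v i ord0 ^+ 2).

Definition dist_set (R : realType) (n : nat) (x : 'cV[R]_n)
    (A : set 'cV[R]_n) : R :=
  inf [set enorm (x - y) | y in A].

Definition basis_vec (R : realType) (n : nat) (i : 'I_n) : 'cV[R]_n :=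
  delta_mx i ord0.

(* g is C^k on U: all iterated partial derivatives of g of order <= k exist and
   are continuous at every point of U. The derivatives are two-sided, so this
   is meant for open U only; g is an arbitrary total function off U. *)
Fixpoint Ck (R : realType) (n : nat) (V : normedModType R) (k : nat)
    (U : set 'cV[R]_n) (g : 'cV[R]_n -> V) : Prop :=
  (forall x, U x -> {for x, continuous g}) /\
  match k with
  | 0%N => True
  | k'.+1 => forall i : 'I_n,
      (forall x, U x -> derivable g x (basis_vec R i)) /\
      Ck k' U (fun x => 'D_(basis_vec R i) g x)
  end.

Definition Ck_sym (R : realType) (n k : nat) (U : set 'cV[R]_n)
    (M : 'cV[R]_n -> 'M[R]_n) : Prop :=
  Ck k U M /\ (forall x, U x -> M x \is symmetricmx).

Definition posdefmx (R : realType) (n : nat) (A : 'M[R]_n) : Prop :=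
  forall v : 'cV[R]_n, v != 0 -> 0 < (v^T *m A *m v) ord0 ord0.

Definition gradient (R : realType) (n : nat) (g : 'cV[R]_n -> R)
    (x : 'cV[R]_n) : 'cV[R]_n :=
  \col_(k < n) 'D_(basis_vec R k) g x.

(* The library's jacobian acts on row vectors, i.e. it is the transpose of the
   usual Jacobian matrix; here row i holds the partials of the i-th component. *)
Definition jacobian_mx (R : realType) (n : nat) (f : 'cV[R]_n -> 'cV[R]_n)
    (x : 'cV[R]_n) : 'M[R]_n :=
  \matrix_(i < n, j < n) 'D_(basis_vec R j) (fun y => f y i ord0) x.

(* phi t is S_t x for t >= 0. Only the values of phi on [0, +oo[ matter; the
   derivative at 0 is two-sided, which is no restriction since a solution on
   [0, +oo[ can always be prolonged to the left of 0 with slope f x. *)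
Definition forward_solution (R : realType) (n : nat)
    (f : 'cV[R]_n -> 'cV[R]_n) (x : 'cV[R]_n) (phi : R -> 'cV[R]_n) : Prop :=
  phi 0 = x /\ forall t : R, 0 <= t -> is_derive t 1 phi (f (phi t)).

Definition periodic_orbit (R : realType) (n : nat)
    (f : 'cV[R]_n -> 'cV[R]_n) (Omega : set 'cV[R]_n) : Prop :=
  exists p : R -> 'cV[R]_n, exists T : R,
    [/\ forall t : R, is_derive t 1 p (f (p t)),
        0 < T /\ (forall t : R, p (t + T) = p t),
        exists t : R, p t <> p 0
      & Omega = range p].

(* Orbital exponential stability; that trajectories starting near Omega exist
   for all t >= 0 is part of the notion. *)
Definition exponentially_stable (R : realType) (n : nat)
    (f : 'cV[R]_n -> 'cV[R]_n) (Omega : set 'cV[R]_n) : Prop :=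
  exists delta : R, exists K : R, exists mu : R,
    [/\ 0 < delta, 0 < K, 0 < mu
      & forall x : 'cV[R]_n, dist_set x Omega < delta ->
          exists2 phi : R -> 'cV[R]_n, forward_solution f x phi
            & forall t : R, 0 <= t ->
                dist_set (phi t) Omega
                  <= K * expR (- (mu * t)) * dist_set x Omega].

(* Solutions of x' = f(x) need not be global in general: S_t x is required to
   exist for all t >= 0 (it is then unique, f being C^1). *)
Definition basin (R : realType) (n : nat) (f : 'cV[R]_n -> 'cV[R]_n)
    (Omega : set 'cV[R]_n) : set 'cV[R]_n :=
  [set x | exists2 phi : R -> 'cV[R]_n, forward_solution f x phi
           & dist_set (phi t) Omega @[t --> +oo] --> (0 : R)].

Definition proj_mx_at (R : realType) (n : nat) (f : 'cV[R]_n -> 'cV[R]_n)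
    (x : 'cV[R]_n) : 'M[R]_n :=
  1%:M - (enorm (f x) ^+ 2)^-1 *: (f x *m (f x)^T).

Definition orbital_derivative (R : realType) (n : nat)
    (f : 'cV[R]_n -> 'cV[R]_n) (M : 'cV[R]_n -> 'M[R]_n) (x : 'cV[R]_n) :
    'M[R]_n :=
  \matrix_(i < n, j < n)
    ((gradient (fun y => M y i j) x)^T *m f x) ord0 ord0.

Definition Lop (R : realType) (n : nat) (f : 'cV[R]_n -> 'cV[R]_n)
    (M : 'cV[R]_n -> 'M[R]_n) (x : 'cV[R]_n) : 'M[R]_n :=
  let D := jacobian_mx f x in
  let s := (enorm (f x) ^+ 2)^-1 in
  orbital_derivative f M x + D^T *m M x + M x *m D
    - s *: (M x *m f x *m (f x)^T *m (D + D^T))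
    - s *: ((D + D^T) *m f x *m (f x)^T *m M x).

(* Main.v *)
(** Let [N := M1 - M2], and let [A := Df - f f^T (Df + Df^T) / |f|^2], so that
    [L M = M' + A^T M + M A].  Along a trajectory [x(t)] in the basin, [L N = 0]
    says that [v^T N(x(t)) w] is constant for all solutions [v], [w] of the
    transverse equation [w' = A(x(t)) w].  This equation preserves [f^T w] and has
    the solution [f / |f|^2].

    Orbital exponential stability makes the solutions with [f^T w = 0] decay:
    adding a suitable multiple of [f] to [w] gives a solution of the variational
    equation, hence a limit of difference quotients of the flow, and the flow
    brings a point at distance [eps] from the orbit to within [K e^(-mu T) eps] of
    it, where the orbit is tangent to [f] to first order.  So the flow contracts
    transversally by 1/2 over a long time [T], first along the orbit and then, by
    Gronwall, in a neighbourhood of it.  Since all other solutions stay bounded,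
    [v^T N w = 0] whenever [f^T w = 0], and [N = g f f^T] for a scalar [g].

    Finally [g = (f / |f|^2)^T N (f / |f|^2)] is continuous and constant along
    trajectories, all of which accumulate on the single trajectory [Omega]; so [g]
    is constant on the basin, and the normalisation at [x0] gives [g = 0].

    The chain rule for [M1] and [M2] needs the basin to be open, which rests on the
    existence of solutions near a given one. *)
Require Import Defs.
From HB Require Import structures.
From mathcomp Require Import all_boot all_order all_algebra.
From mathcomp Require Import all_classical all_reals all_analysis.
From mathcomp Require Import ring lra.

Set Implicit Arguments.
Unset Strict Implicit.
Unset Printing Implicit Defensive.
Import Order.TTheory GRing.Theory Num.Theory.
Import numFieldNormedType.Exports.
Local Open Scope classical_set_scope.
Local Open Scope ring_scope.

(** * Calculus along curves *)

Lemma is_derive_mxP (R : realType) (V : normedModType R) (m n : nat)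
    (M : V -> 'M[R]_(m, n)) (D : 'M[R]_(m, n)) (x v : V) :
  is_derive x v M D <-> forall i j, is_derive x v (fun y => M y i j) (D i j).
Proof.
split=> [[dM <-] i j|dM].
  have /derivable_mxP dMij := dM.
  by split; [exact: dMij|rewrite derive_mx// mxE].
have dM' : derivable M x v by apply/derivable_mxP => i j; case: (dM i j).
split=> //; rewrite derive_mx//; apply/matrixP => i j; rewrite mxE.
by have [_ ->] := dM i j.
Qed.

Lemma is_derive_mulmx (R : realType) (V : normedModType R) (m n p : nat)
    (A : V -> 'M[R]_(m, n)) (B : V -> 'M[R]_(n, p)) A' B' (x v : V) :
  is_derive x v A A' -> is_derive x v B B' ->
  is_derive x v (fun y => A y *m B y) (A' *m B x + A x *m B').
Proof.
move=> /is_derive_mxP dA /is_derive_mxP dB; apply/is_derive_mxP => i j.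
rewrite [X in is_derive _ _ X _](_ : _ =
  \sum_(k < n) (fun y => A y i k) * (fun y => B y k j)); last first.
  by apply/funext => y; rewrite mxE fct_sumE.
have H k : is_derive x v ((fun y => A y i k) * (fun y => B y k j))
   (A x i k *: B' k j + B x k j *: A' i k) by exact: is_deriveM.
apply: is_derive_eq.
rewrite !mxE -big_split/=; apply: eq_bigr => k _.
by rewrite /GRing.scale/= addrC [B x k j * _]mulrC.
Qed.

Lemma is_derive_trmx (R : realType) (V : normedModType R) (m n : nat)
    (A : V -> 'M[R]_(m, n)) A' (x v : V) :
  is_derive x v A A' -> is_derive x v (fun y => (A y)^T) A'^T.
Proof.
move=> /is_derive_mxP dA; apply/is_derive_mxP => i j; rewrite mxE.
by rewrite (_ : (fun y => _) = fun y => A y j i)//; apply/funext => y; rewrite mxE.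
Qed.

(** Multiplying out the difference quotient gives an estimate that also makes sense at [h = 0], a
    convenient form for shifting curves in time and gluing them. *)
Lemma is_deriveP (R : realType) (W : normedModType R) (phi : R -> W) (t : R)
    (v : W) :
  is_derive t 1 phi v <->
  forall e : R, 0 < e -> \forall h \near (0 : R),
    `|phi (t + h) - phi t - h *: v| <= e * `|h|.
Proof.
have E h : h != 0 -> `|phi (t + h) - phi t - h *: v| =
    `|v - h^-1 *: (phi (h *: 1 + t) - phi t)| * `|h|.
  move=> h0; rewrite -[in RHS]normrN opprB mulrC -normrZ scalerBr scalerA divff//.
  by rewrite scale1r -[h%:A]/(h * 1) mulr1 [h + t]addrC.
split=> [[dphi dv] e e0|H].
  have : (fun h => h^-1 *: ((phi \o shift t) h%:A - phi t)) @ 0^' --> v.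
    by rewrite -dv; exact: dphi.
  move=> /cvgrPdist_le /(_ _ e0).
  rewrite !near_withinE; apply: filterS => h He.
  have [->|h0] := eqVneq h 0; first by rewrite addr0 subrr scale0r !subr0 !normr0 mulr0.
  by rewrite E// ler_wpM2r//; exact: He.
suff cv : (fun h => h^-1 *: ((phi \o shift t) h%:A - phi t)) @ 0^' --> v.
  split; first by apply/cvg_ex; exists v.
  exact: cvg_lim.
apply/cvgrPdist_le => e e0; rewrite near_withinE.
apply: filterS (H _ e0) => h He h0.
by rewrite -(ler_pM2r (_ : 0 < `|h|)) ?normr_gt0// -E.
Qed.

Lemma is_derive_continuous (R : realType) (W : normedModType R) (phi : R -> W) (t : R) (v : W) :
  is_derive t 1 phi v -> {for t, continuous phi}.
Proof.
by case=> /derivable1_diffP/differentiable_continuous.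
Qed.

Lemma mx_entry_le (R : realType) (m n : nat) (A : 'M[R]_(m, n)) i j :
  `|A i j| <= `|A|.
Proof. by rewrite [leRHS]/Num.norm/= mx_normrE; exact: (le_bigmax _ _ (i, j)). Qed.

Lemma mx_norm_leP (R : realType) (m n : nat) (A : 'M[R]_(m, n)) (r : R) :
  0 <= r -> (`|A| <= r <-> forall i j, `|A i j| <= r).
Proof.
move=> r0; split=> [Ar i j|H]; first exact: le_trans (mx_entry_le _ _ _) Ar.
rewrite [leLHS]/Num.norm/= mx_normrE; apply: bigmax_le => // -[i j] _; exact: H.
Qed.

Lemma mulmx_norm_le (R : realType) (m n p : nat) (A : 'M[R]_(m, n))
    (B : 'M[R]_(n, p)) : `|A *m B| <= n%:R * (`|A| * `|B|).
Proof.
apply/mx_norm_leP; first by rewrite !mulr_ge0.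
move=> i j; rewrite mxE (le_trans (ler_norm_sum _ _ _))//.
rewrite -[X in _ <= X%:R * _]card_ord -sum1_card natr_sum mulr_suml ler_sum// => k _.
by rewrite mul1r normrM ler_pM// mx_entry_le.
Qed.

Lemma ge0_derive_le (R : realType) (h h' : R -> R) (a b : R) : a <= b ->
  (forall t, a <= t <= b -> is_derive t 1 h (h' t)) ->
  (forall t, a <= t <= b -> 0 <= h' t) -> h a <= h b.
Proof.
move=> ab dh h0.
have dh' x : x \in `]a, b[%R -> is_derive x 1 h (h' x).
  by rewrite in_itv/= => /andP[/ltW ? /ltW ?]; apply: dh; apply/andP.
have ch : {within `[a, b], continuous h}.
  by apply: derivable_within_continuous => x; rewrite in_itv/= => /dh; case.
have [c] := MVT_segment ab dh' ch.
by rewrite in_itv/= => /h0 hc E; rewrite -subr_ge0 E mulr_ge0// subr_ge0.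
Qed.

(** Since the norm is the maximum of the entries, it is enough that [k + phi i j] and [k - phi i j]
    are nondecreasing for every entry. A bounding function [k], rather than a constant speed, lets
    exponential weights pass through. *)
Lemma dominated_derive_le (R : realType) (m n : nat) (phi phi' : R -> 'M[R]_(m, n))
    (k k' : R -> R) (a b : R) : a <= b ->
  (forall t, a <= t <= b -> is_derive t 1 phi (phi' t)) ->
  (forall t, a <= t <= b -> is_derive t 1 k (k' t)) ->
  (forall t, a <= t <= b -> `|phi' t| <= k' t) ->
  `|phi b - phi a| <= k b - k a.
Proof.
move=> ab dphi dk le.
have kk : k a <= k b.
  apply: (ge0_derive_le ab dk) => t /le; exact: le_trans.
apply/mx_norm_leP; first by rewrite subr_ge0.
move=> i j; rewrite !mxE.
have dij t : a <= t <= b -> is_derive t 1 (fun y => phi y i j) (phi' t i j).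
  by move=> /dphi/is_derive_mxP.
have lij t : a <= t <= b -> `|phi' t i j| <= k' t.
  by move=> /le; apply: le_trans; exact: mx_entry_le.
rewrite ler_norml; apply/andP; split.
- suff : k a + phi a i j <= k b + phi b i j by lra.
  apply: (@ge0_derive_le _ (k + (fun y => phi y i j)) (fun t => k' t + phi' t i j)) => //.
    by move=> t tab; apply: is_deriveD; [exact: dk|exact: dij].
  by move=> t /lij; rewrite ler_norml => /andP[]; lra.
- suff : k a - phi a i j <= k b - phi b i j by lra.
  apply: (@ge0_derive_le _ (k - (fun y => phi y i j)) (fun t => k' t - phi' t i j)) => //.
    by move=> t tab; apply: is_deriveB; [exact: dk|exact: dij].
  by move=> t /lij; rewrite ler_norml => /andP[]; lra.
Qed.

(** The constant [C] is fixed before the curve, so it serves all solutions compared on [[0, T]]. The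
    proof runs on the squared Euclidean norm, which is differentiable where the sup norm need not
    be. *)
Lemma gronwall (R : realType) (n : nat) (T L : R) : 0 <= T -> 0 <= L ->
  exists2 C : R, 0 < C &
    forall (u u' : R -> 'cV[R]_n) (b : R), 0 <= b ->
      (forall t, 0 <= t <= T -> is_derive t 1 u (u' t)) ->
      (forall t, 0 <= t <= T -> `|u' t| <= L * `|u t| + b) ->
      forall t, 0 <= t <= T -> `|u t| <= C * (`|u 0| + b).
Proof.
(* The rate comes from [2 |u| (L |u| + b) <= (2 L + 1) |u|^2 + b^2], summed over the [n]
   coordinates. *)
move=> T0 L0; set c := n%:R * (2 * L + 1).
have c0 : 0 <= c by rewrite mulr_ge0// addr_ge0// mulr_ge0.
set Csq := expR (c * T) * ((n%:R + 1) * (1 + T)).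
have Csq0 : 0 < Csq.
  by have n0 := ler0n R n; rewrite !mulr_gt0 ?expR_gt0//; lra.
exists (Num.sqrt Csq); first by rewrite sqrtr_gt0.
move=> u u' b b0 du le t /andP[t0 tT].
pose E s := \sum_(i < n) u s i ord0 ^+ 2.
have E_ge s : `|u s| ^+ 2 <= E s.
  have E0 : 0 <= E s by apply: sumr_ge0 => i _; rewrite sqr_ge0.
  rewrite -[leRHS]sqr_sqrtr// ler_sqr ?nnegrE ?sqrtr_ge0//.
  apply/mx_norm_leP; first exact: sqrtr_ge0.
  move=> i j; rewrite (ord1 j) -sqrtr_sqr ler_sqrt// /E (bigD1 i)//= lerDl.
  by apply: sumr_ge0 => k _; rewrite sqr_ge0.
have E_le s : E s <= n%:R * `|u s| ^+ 2.
  rewrite -[X in X%:R]card_ord -sum1_card natr_sum mulr_suml ler_sum// => k _.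
  by rewrite mul1r -real_normK ?num_real// ler_sqr ?nnegrE// mx_entry_le.
pose E' s := \sum_(i < n) (u s i ord0 *+ 2 * u' s i ord0).
have dE s : 0 <= s <= T -> is_derive s 1 E (E' s).
  move=> /du /is_derive_mxP dus.
  rewrite (_ : E = \sum_(i < n) (fun s => u s i ord0) ^+ 2); last first.
    by apply/funext => x; rewrite fct_sumE.
  apply: is_derive_eq; apply: eq_bigr => i _.
  by rewrite expr1 /GRing.scale/= mulr_natl.
have E'_le s : 0 <= s <= T -> E' s <= c * E s + n%:R * b ^+ 2.
  move=> sT; apply: (@le_trans _ _ (n%:R * ((2 * L + 1) * `|u s| ^+ 2 + b ^+ 2))).
    rewrite -[X in X%:R]card_ord -sum1_card natr_sum mulr_suml ler_sum// => k _.
    rewrite mul1r (le_trans (ler_norm _))// normrM normrMn.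
    apply: (@le_trans _ _ (`|u s| *+ 2 * (L * `|u s| + b))).
      rewrite ler_pM//; first by rewrite lerMn2r/= mx_entry_le.
      by apply: le_trans (le s sT); exact: mx_entry_le.
    rewrite -subr_ge0.
    rewrite (_ : _ - _ = (`|u s| - b) ^+ 2); last by ring.
    by rewrite sqr_ge0.
  by rewrite mulrDr lerD2r mulrA ler_wpM2l.
(* Integrating factor [exp (- c s)]; as it is at most 1, subtracting the linear term absorbs the
   inhomogeneity, and [G] is nonincreasing. *)
pose G s := expR (- c * s) * E s - n%:R * b ^+ 2 * s.
have : - G 0 <= - G t.
  have e1 (s : R) : is_derive s 1 (fun s => expR (- c * s)) (- c * expR (- c * s)).
    have d1 : is_derive s 1 ( *%R (- c)) (- c).
      have := @is_deriveZ R R R id (- c) s 1 1 _.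
      by move=> /(_ (is_derive_id _ _)); rewrite /GRing.scale/= mulr1.
    have := is_derive1_comp (is_derive_expR (- c * s)) d1.
    by rewrite mulrC.
  apply: (@ge0_derive_le _ (fun s => - G s)
      (fun s => - (expR (- c * s) * E' s + E s * (- c * expR (- c * s)) - n%:R * b ^+ 2))).
  - exact: t0.
  - move=> s /andP[s0 st]; have sT : 0 <= s <= T by rewrite s0 (le_trans st).
    have := dE s sT => dEs; have := e1 s => e1s.
    rewrite (_ : (fun s => - G s) =
      - ((fun s => expR (- c * s)) * E - (n%:R * b ^+ 2) *: id)); last by apply/funext.
    by apply: is_derive_eq; rewrite -[_%:A]/(_ * 1) mulr1 /GRing.scale/=.
  - move=> s /andP[s0 st]; have sT : 0 <= s <= T by rewrite s0 (le_trans st).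
    have := E'_le s sT.
    have e0 := expR_gt0 (- c * s).
    have e1' : expR (- c * s) <= 1 by rewrite -[leRHS]expR0 ler_expR mulNr oppr_le0 mulr_ge0.
    have nb : 0 <= n%:R * b ^+ 2 by rewrite mulr_ge0// sqr_ge0.
    move: (expR _) e0 e1' (E s) (E' s) (n%:R * b ^+ 2) nb => e e0 e1' Es E's N N0 h.
    have : e * E's <= e * (c * Es + N) by rewrite ler_wpM2l// ltW.
    have : e * N <= N by rewrite ler_piMl.
    by lra.
rewrite /G !mulr0 expR0 mul1r subr0 => h.
have {}h : expR (- c * t) * E t <= E 0 + n%:R * b ^+ 2 * t by lra.
have Et : E t <= Csq * (`|u 0| + b) ^+ 2.
  have -> : E t = expR (c * t) * (expR (- c * t) * E t).
    by rewrite mulrA -expRD mulNr subrr expR0 mul1r.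
  rewrite /Csq -[leRHS]mulrA ler_pM ?expR_ge0//.
    by rewrite mulr_ge0 ?expR_ge0//; apply: sumr_ge0 => i _; rewrite sqr_ge0.
    by rewrite ler_expR ler_wpM2l.
  apply: (le_trans h); apply: (@le_trans _ _ (n%:R * `|u 0| ^+ 2 + n%:R * b ^+ 2 * T)).
    by rewrite lerD// ler_wpM2l// mulr_ge0// sqr_ge0.
  have u0 := normr_ge0 (u 0); have n0 := ler0n R n.
  have u2 := sqr_ge0 `|u 0|; have b2 := sqr_ge0 b.
  have ub : `|u 0| ^+ 2 + b ^+ 2 <= (`|u 0| + b) ^+ 2.
    by rewrite sqrrD; have := mulr_ge0 u0 b0; lra.
  apply: (@le_trans _ _ ((n%:R + 1) * (1 + T) * (`|u 0| ^+ 2 + b ^+ 2))).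
    rewrite -subr_ge0 (_ : _ - _ = (n%:R + 1 + (n%:R+1)* T) * b ^+ 2 - n%:R * b ^+ 2 * T
      + (n%:R * T + 1 + T) * `|u 0| ^+ 2); last by ring.
    rewrite (_ : _ - _ = (n%:R + 1 + T) * b ^+ 2); last by ring.
    by rewrite addr_ge0// mulr_ge0// addr_ge0// ?addr_ge0// mulr_ge0.
  by rewrite ler_wpM2l// mulr_ge0// addr_ge0.
rewrite -(@ler_sqr _ _ (_ * _)) ?nnegrE ?mulr_ge0 ?sqrtr_ge0 ?addr_ge0//.
rewrite exprMn sqr_sqrtr ?(ltW Csq0)//.
exact: le_trans Et.
Qed.

Lemma antiderivative_real (R : realType) (g : R -> R) : continuous g ->
  exists2 G : R -> R, G 0 = 0 & forall t : R, 0 <= t -> is_derive t 1 G (g t).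
Proof.
move=> cg.
(* Integrating from -1 puts 0 in the interior of the interval, so the derivative at 0 is
   two-sided. *)
pose H x := (\int[lebesgue_measure]_(t in [set` `[(-1) : R, x]]) (g t))%R.
have dH (t : R) : 0 <= t -> is_derive t 1 H (g t).
  move=> t0; have t1 : t < t + 1 by rewrite ltrDl.
  have ig : lebesgue_measure.-integrable `[(-1) : R, t + 1] (EFin \o g).
    apply: continuous_compact_integrable; first exact: segment_compact.
    exact: continuous_subspaceT.
  have [] := continuous_FTC1_closed t1 ig (_ : -1 < t) (cg t).
    by apply: lt_le_trans t0; rewrite ltrN10.
  by move=> d1 d2; split; [exact: d1|rewrite -derive1E].
exists (fun x => H x - H 0); first by rewrite subrr.
move=> t /dH dHt.
rewrite (_ : (fun x => _) = H - cst (H 0)); last by apply/funext.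
by apply: is_derive_eq; rewrite subr0.
Qed.

Lemma antiderivative (R : realType) (n : nat) (g : R -> 'cV[R]_n) : continuous g ->
  exists2 G : R -> 'cV[R]_n, G 0 = 0 & forall t : R, 0 <= t -> is_derive t 1 G (g t).
Proof.
move=> cg.
have /= /choice[G HG] : forall i : 'I_n, exists Gi : R -> R, Gi 0 = 0 /\
    forall t : R, 0 <= t -> is_derive t 1 Gi (g t i ord0).
  move=> i; have [|Gi ? ?] := @antiderivative_real R (fun t => g t i ord0).
    move=> t; apply: (@continuous_comp _ _ _ g (fun v : 'cV[R]_n => v i ord0)).
      exact: cg.
    exact: coord_continuous.
  by exists Gi.
exists (fun t => \col_i G i t).
  by apply/matrixP => i j; rewrite !mxE (HG i).1.
move=> t t0; apply/is_derive_mxP => i j.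
rewrite (_ : (fun _ => _) = G i); last by apply/funext => y; rewrite mxE.
by rewrite (ord1 j); exact: (HG i).2.
Qed.

(** * The Picard theorem *)

Lemma geometric_small (R : realType) (B e : R) : 0 < e ->
  exists k : nat, `|B * 2^-1 ^+ k| < e.
Proof.
move=> e0.
have h1 : `|2^-1 : R| < 1 by rewrite ger0_norm ?invr_ge0// invf_lt1// ltr1n.
have := @cvg_geometric R B _ h1.
move=> /cvgr0Pnorm_lt /(_ _ e0) [k _ Hk]; exists k; exact: (Hk k (leqnn k)).
Qed.

Lemma geometric_limit (R : realType) (n : nat) (x : nat -> 'cV[R]_n)
    (B : R) : (forall k, `|x k.+1 - x k| <= B * 2^-1 ^+ k) ->
  exists l : 'cV[R]_n, x @ \oo --> l /\ forall k, `|l - x k| <= 2 * B * 2^-1 ^+ k.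
Proof.
move=> H.
(* The subtracted term is the rest of the geometric series; keeping it makes the induction on [m]
   close. *)
have HH k m : `|x (k + m)%N - x k| <= 2 * B * 2^-1 ^+ k - 2 * B * 2^-1 ^+ (k + m).
  elim: m => [|m IH]; first by rewrite addn0 !subrr normr0.
  rewrite addnS -(subrK (x (k + m)%N) (x (k + m).+1)) -addrA.
  apply: (le_trans (ler_normD _ _)).
  have := H (k + m)%N; rewrite exprS; lra.
have B0 : 0 <= B.
  by have := le_trans (normr_ge0 _) (H 0%N); rewrite expr0 mulr1.
have HB k m : `|x (k + m)%N - x k| <= 2 * B * 2^-1 ^+ k.
  apply: (le_trans (HH k m)); rewrite gerBl !mulr_ge0// exprn_ge0//.
have cx : cvg (x @ \oo).
  apply/cauchy_cvgP/cauchy_exP => e e0.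
  have [k Hk] := geometric_small (2 * B) e0.
  exists (x k); rewrite -ball_normE /=.
  exists k => // m /= km; rewrite distrC -(subnKC km).
  apply: le_lt_trans Hk; apply: le_trans (HB _ _) _; exact: ler_norm.
exists (lim (x @ \oo)); split; first exact: cx.
move=> k.
have c2 : (fun m => `|x (k + m)%N - x k|) @ \oo --> `|lim (x @ \oo) - x k|.
  apply: cvg_norm; apply: cvgB; last exact: cvg_cst.
  have := cx; rewrite -(cvg_shiftn k) => h.
  under eq_fun do rewrite addnC; exact: h.
apply: (cvgr_to_le c2); exact: nearW.
Qed.

Lemma max0_continuous (R : realType) : continuous (fun t : R => Num.max t 0).
Proof.
move=> t; apply: (@continuous_max R R (fun t => t) (cst 0)).
  exact: cvg_id.
exact: cvg_cst.
Qed.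

Lemma continuous_bounded_itv (R : realType) (V : normedModType R) (g : R -> V)
    (a b : R) : a <= b -> continuous g ->
  exists2 C : R, 0 <= C & forall t, a <= t <= b -> `|g t| <= C.
Proof.
move=> ab cg.
have [|c _ Hc] := @EVT_max R (fun t => `|g t|) a b ab.
  apply: continuous_subspaceT => t; apply: cvg_norm; exact: cg.
exists `|g c| => // t tab; apply: Hc; by rewrite in_itv/=.
Qed.

Section picard.
Variables (R : realType) (n : nat) (F : R -> 'cV[R]_n -> 'cV[R]_n) (u0 : 'cV[R]_n).
Hypothesis Flip : forall tau : R, 0 <= tau -> exists2 L : R, 0 <= L &
  forall (t : R) a b, 0 <= t <= tau -> `|F t a - F t b| <= L * `|a - b|.
Hypothesis Fcont : forall u : R -> 'cV[R]_n, continuous u ->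
  continuous (fun t => F t (u t)).

(** Picard iteration in the norm weighted by [exp (- 2 L t)]: there the integral operator halves
    distances on [[0, tau]] for every [tau], so no interval has to be short and the solution exists
    for all [t >= 0]. *)
Lemma picard : exists2 u : R -> 'cV[R]_n, u 0 = u0 &
  forall t : R, 0 <= t -> is_derive t 1 u (F t (u t)).
Proof.
(* The zero function is a default for discontinuous integrands; below, [I] is applied to continuous
   ones only. *)
have /choice[I HI] : forall g : R -> 'cV[R]_n, exists G : R -> 'cV[R]_n,
    continuous g ->
    G 0 = 0 /\ forall t : R, 0 <= t -> is_derive t 1 G (g t).
  move=> g; have [cg|ncg] := pselect (continuous g).
    by have [G G0 dG] := antiderivative cg; exists G.
  by exists (cst 0).
(* Clipping time at 0 keeps the iterates continuous on all of [R], although antiderivatives are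
   controlled only for [t >= 0]. *)
pose step (u : R -> 'cV[R]_n) := fun t => u0 + I (fun s => F s (u s)) (Num.max t 0).
pose x k := iter k step (cst u0).
have cstep u : continuous u -> continuous (step u).
  move=> cu t; have [_ dI] := HI _ (Fcont cu).
  have ci : {for t, continuous (I (fun s => F s (u s)) \o (fun t => Num.max t 0))}.
    apply: continuous_comp; first exact: max0_continuous.
    apply: is_derive_continuous (dI _ _).
    by rewrite le_max lexx orbT.
  exact: (cvgD (cvg_cst u0) ci).
have cx k : continuous (x k).
  by elim: k => [|k IH] /=; [move=> t; exact: cvg_cst|exact: cstep].
have xmax k t : x k t = x k (Num.max t 0).
  case: k => //= k; congr (_ + I _ _); symmetry.
  by apply/max_idPl; rewrite le_max lexx orbT.
(* One integration gains a factor [L / c <= 1 / 2] on differences that grow at most like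
   [exp (c t)]. *)
have stepB u v tau L (c K : R) : continuous u -> continuous v ->
    (forall (t : R) a b, 0 <= t <= tau -> `|F t a - F t b| <= L * `|a - b|) ->
    0 <= L -> 0 <= K -> 2 * L <= c ->
    (forall t : R, 0 <= t <= tau -> `|u t - v t| <= K * expR (c * t)) ->
    forall t : R, 0 <= t <= tau ->
    `|I (fun s => F s (u s)) t - I (fun s => F s (v s)) t| <= K / 2 * expR (c * t).
  move=> cu cv lip L0 K0 Lc uv t /andP[t0 tT].
  have [Iu0 dIu] := HI _ (Fcont cu); have [Iv0 dIv] := HI _ (Fcont cv).
  have de (s : R) : is_derive s 1 (fun s => K / 2 * expR (c * s)) (K / 2 * (c * expR (c * s))).
    have d1 : is_derive s 1 ( *%R c) c.
      have := @is_deriveZ R R R id c s 1 1 _.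
      by move=> /(_ (is_derive_id _ _)); rewrite /GRing.scale/= mulr1.
    have := is_derive1_comp (is_derive_expR (c * s)) d1; rewrite [_ * c]mulrC => d2.
    exact: (is_deriveZ (K / 2) d2).
  have : `|(I (fun s => F s (u s)) - I (fun s => F s (v s))) t -
     (I (fun s => F s (u s)) - I (fun s => F s (v s))) 0| <=
     K / 2 * expR (c * t) - K / 2 * expR (c * 0).
    apply: (@dominated_derive_le _ _ _ _ (fun s => F s (u s) - F s (v s))
      (fun s => K / 2 * expR (c * s)) (fun s => K / 2 * (c * expR (c * s))) 0 t t0).
    - by move=> s /andP[s0 st]; apply: is_deriveB; [exact: dIu|exact: dIv].
    - move=> s /andP[s0 st]; have sT : 0 <= s <= tau by rewrite s0 (le_trans st).
      apply: (le_trans (lip _ _ _ sT)).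
      apply: (@le_trans _ _ (L * (K * expR (c * s)))); first by rewrite ler_wpM2l// uv.
      rewrite (_ : K / 2 * _ = c / 2 * (K * expR (c * s))); last by ring.
      rewrite ler_wpM2r ?mulr_ge0 ?expR_ge0//; lra.
  rewrite !fctE Iu0 Iv0 subrr subr0 => h; apply: (le_trans h).
  by rewrite gerBl mulr_ge0 ?expR_ge0// mulr_ge0// invr_ge0.
have xB tau : 0 <= tau -> exists2 B : R, 0 <= B &
    forall k t, t <= tau -> `|x k.+1 t - x k t| <= B * 2^-1 ^+ k.
  move=> tau0; have [L L0 lip] := Flip tau0.
  have c1 : continuous (fun t => x 1%N t - x 0%N t).
    by move=> t; apply: cvgB; exact: cx.
  have [b b0 Hb] := continuous_bounded_itv tau0 c1.
  have key k t : 0 <= t <= tau -> `|x k.+1 t - x k t| <= b * 2^-1 ^+ k * expR (2 * L * t).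
    elim: k t => [|k IH] t tT.
      rewrite expr0 mulr1 (le_trans (Hb _ tT))// ler_peMr// -expR0 ler_expR.
      by move: tT => /andP[? _]; rewrite !mulr_ge0.
    rewrite [x k.+2]/= [x k.+1]/= /step.
    have -> : Num.max t 0 = t by apply/max_idPl; case/andP: tT.
    rewrite opprD addrACA subrr add0r.
    have := stepB _ _ tau L (2 * L) (b * 2^-1 ^+ k) (cx k.+1) (cx k) lip L0 _ _ IH t tT.
    rewrite exprSr mulrA; apply => //.
    by rewrite mulr_ge0// exprn_ge0// invr_ge0.
  exists (b * expR (2 * L * tau)); first by rewrite mulr_ge0// expR_ge0.
  move=> k t ttau; rewrite (xmax k.+1) (xmax k).
  have tT : 0 <= Num.max t 0 <= tau by rewrite le_max lexx orbT ge_max ttau.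
  apply: (le_trans (key _ _ tT)); rewrite mulrAC ler_wpM2r//.
  by rewrite ler_wpM2l// ler_expR ler_wpM2l ?mulr_ge0//; case/andP: tT.
have /choice[ui Hui] : forall t : R, exists l : 'cV[R]_n, x ^~ t @ \oo --> l.
  move=> t; have [B B0 /(_ _ _ (ler_norm t)) HB] := xB _ (normr_ge0 t).
  by have [l [? _]] := geometric_limit HB; exists l.
have uiB tau : 0 <= tau -> exists2 B : R, 0 <= B &
    forall k t, t <= tau -> `|ui t - x k t| <= B * 2^-1 ^+ k.
  move=> tau0; have [B B0 HB] := xB _ tau0; exists (2 * B); first by rewrite mulr_ge0.
  move=> k t tT; have [l [cl Hl]] := geometric_limit (fun k => HB k t tT).
  suff -> : ui t = l by exact: Hl.
  exact: (cvg_unique _ (Hui t) cl).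
have cui : continuous ui.
  move=> t; apply/cvgrPdist_le => e e0.
  have tau0 : 0 <= `|t| + 1 by rewrite addr_ge0.
  have [B B0 HB] := uiB _ tau0.
  have e3 : 0 < e / 3 by lra.
  have [k Hk] := geometric_small B e3.
  have {}HB s : s <= `|t| + 1 -> `|ui s - x k s| <= e / 3.
    move=> hs; apply: le_trans (HB k s hs) _; apply: le_trans (ltW Hk); exact: ler_norm.
  have t1 : t < `|t| + 1 by rewrite (le_lt_trans (ler_norm t))// ltrDl.
  have /cvgrPdist_le /(_ _ e3) := cx k t.
  have := lt_nbhsl t1.
  apply: filterS2 => s st xs.
  have := HB s (ltW st); have := HB t (ltW t1).
  rewrite [`|ui s - _|]distrC => h1 h2.
  have -> : ui t - ui s = (ui t - x k t) + (x k t - x k s) + (x k s - ui s).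
    by rewrite !addrA !subrK.
  apply: (le_trans (ler_normD _ _)); have := ler_normD (ui t - x k t) (x k t - x k s); lra.
have [I0 dI] := HI _ (Fcont cui).
(* The limit [ui] is only known to be continuous. One more integration gives a differentiable [u],
   and large [k] in the iteration identifies the two. *)
pose u t := u0 + I (fun s => F s (ui s)) t.
have uE t : 0 <= t -> u t = ui t.
  move=> t0; have [L L0 lip] := Flip t0.
  have [B B0 HB] := uiB _ t0.
  apply/eqP; rewrite -subr_eq0 -normr_le0; apply/ler_addgt0Pl => e e0; rewrite addr0.
  have [k Hk] := geometric_small (B / 2 * expR (2 * L * t) + B / 2) e0.
  have tt : 0 <= t <= t by rewrite t0 lexx.
  have h1 : `|I (fun s => F s (ui s)) t - I (fun s => F s (x k s)) t| <=
      B * 2^-1 ^+ k / 2 * expR (2 * L * t).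
    apply: (stepB _ _ t L) => //.
      by rewrite mulr_ge0// exprn_ge0// invr_ge0.
    move=> s /andP[s0 st]; apply: le_trans (HB k s st) _.
    rewrite ler_peMr ?mulr_ge0 ?exprn_ge0 ?invr_ge0//.
    by rewrite -expR0 ler_expR !mulr_ge0.
  have h2 := HB k.+1 t (lexx t).
  rewrite (_ : u t - ui t =
    I (fun s => F s (ui s)) t - I (fun s => F s (x k s)) t - (ui t - x k.+1 t)); last first.
    rewrite /u [x k.+1]/= /step; have -> : Num.max t 0 = t by apply/max_idPl.
    rewrite opprB addrA [u0 + I (fun s => F s (x k s)) t]addrC.
    by rewrite [_ - _ + (_ + _)]addrA subrK [_ + u0]addrC.
  apply: (le_trans (ler_normB _ _)); apply: le_trans (ltW Hk).
  apply: le_trans (ler_norm _).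
  move: h1 h2; rewrite exprS; lra.
exists u; first by rewrite /u I0 addr0.
move=> t t0; rewrite uE//.
rewrite (_ : u = cst u0 + I (fun s => F s (ui s))); last by apply/funext.
have := dI t t0 => dIt.
by apply: is_derive_eq; rewrite add0r.
Qed.

End picard.

(** * Functions with continuous partial derivatives *)

Lemma is_derive_line (R : realType) (V W : normedModType R) (G : V -> W) (x v : V)
    (s : R) : derivable G (x + s *: v) v ->
  is_derive s 1 (fun s => G (x + s *: v)) ('D_v G (x + s *: v)).
Proof.
move=> dG; apply/is_deriveP => e e0.
have : is_derive (0 : R) 1 (fun h : R => G (h *: v + (x + s *: v))) ('D_v G (x + s *: v)).
  have := dG; rewrite derivable1P => dG1.
  split; first by move: dG1; rewrite /derivable/=.
  rewrite /derive; do 2 f_equal; apply/funext => h/=.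
  by rewrite addr0 scale0r add0r -[h%:A]/(h * 1) mulr1.
move=> /is_deriveP /(_ _ e0); apply: filterS => h.
have -> : x + (s + h) *: v = h *: v + (x + s *: v) by rewrite scalerDl addrA addrC.
by rewrite scale0r !add0r.
Qed.

Section multivariable.
Variables (R : realType) (n p q : nat).
Implicit Types (G : 'cV[R]_n -> 'M[R]_(p, q)) (a b z v : 'cV[R]_n).

Definition has_partials G z := forall i : 'I_n, derivable G z (basis_vec R i).

(** Linear in [v] by construction; [is_derive_along] shows that it is the derivative along curves
    when the partials are continuous. *)
Definition dirder G b v : 'M[R]_(p, q) :=
  \sum_(i < n) v i ord0 *: 'D_(basis_vec R i) G b.

(** A ball of the sup norm is a box. *)
Lemma cV_between a a' b (rho : R) (h : 'cV[R]_n) : `|a - b| <= rho -> `|a' - b| <= rho ->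
  (forall i, Num.min (a i ord0) (a' i ord0) <= h i ord0 <= Num.max (a i ord0) (a' i ord0)) ->
  `|h - b| <= rho.
Proof.
move=> ab a'b H; have r0 : 0 <= rho by exact: le_trans (normr_ge0 _) ab.
apply/mx_norm_leP => // i j; rewrite (ord1 j) !mxE.
have := le_trans (mx_entry_le (a - b) i ord0) ab.
have := le_trans (mx_entry_le (a' - b) i ord0) a'b.
have := H i; rewrite !mxE !ler_norml ge_min le_max.
by move=> /andP[/orP[] ? /orP[] ?] /andP[? ?] /andP[? ?]; apply/andP; split; lra.
Qed.

(** Pass from [a'] to [a] one coordinate at a time: the corners [h k] and the segments between them
    stay in the box, and each of the [n] steps is a one-variable mean value estimate. *)
Lemma partials_lipschitz G b (rho m : R) : 0 <= m ->
  (forall z, `|z - b| <= rho -> has_partials G z /\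
     forall i, `|'D_(basis_vec R i) G z| <= m) ->
  forall a a', `|a - b| <= rho -> `|a' - b| <= rho ->
    `|G a - G a'| <= n%:R * m * `|a - a'|.
Proof.
move=> m0 H a a' ab a'b.
pose h (k : nat) : 'cV[R]_n := \col_i (if (i < k)%N then a i ord0 else a' i ord0).
have hn : h n = a by apply/matrixP => i j; rewrite mxE ltn_ord (ord1 j).
have h0 : h 0%N = a' by apply/matrixP => i j; rewrite mxE ltn0 (ord1 j).
have step (k : 'I_n) : `|G (h k.+1) - G (h k)| <= m * `|a - a'|.
  pose d := a k ord0 - a' k ord0.
  have hS : h k.+1 = h k + d *: basis_vec R k.
    apply/matrixP => i j; rewrite !mxE (ord1 j) eqxx andbT ltnS.
    have [->|ik] := eqVneq i k; first by rewrite leqnn ltnn mulr1 addrC subrK.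
    by rewrite leq_eqVlt (inj_eq val_inj) (negbTE ik) mulr0 addr0.
  have dl : `|d| <= `|a - a'| by have := mx_entry_le (a - a') k ord0; rewrite !mxE.
  have inb (s : R) : Num.min 0 d <= s <= Num.max 0 d -> `|h k + s *: basis_vec R k - b| <= rho.
    move=> sd; apply: cV_between ab a'b _ => i; rewrite !mxE eqxx andbT.
    have [->|ik] := eqVneq i k.
      move: sd; rewrite ltnn mulr1 !ge_min !le_max /d.
      by move=> /andP[/orP[] ? /orP[] ?]; apply/andP; split; apply/orP;
        (try by left; lra); right; lra.
    rewrite mulr0 addr0; case: ifP => _; by rewrite ge_min le_max lexx ?orbT.
  have dG (s : R) : Num.min 0 d <= s <= Num.max 0 d ->
     is_derive s 1 (fun s => G (h k + s *: basis_vec R k))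
       ('D_(basis_vec R k) G (h k + s *: basis_vec R k)).
    by move=> /inb/H[dG _]; apply: is_derive_line; exact: dG.
  have dk (s : R) : is_derive s 1 (fun s => m * s) m.
    have := @is_deriveZ R R R id m s 1 1 _.
    by move=> /(_ (is_derive_id _ _)); rewrite /GRing.scale/= mulr1.
  have Ek : h k = h k + 0 *: basis_vec R k by rewrite scale0r addr0.
  apply: (@le_trans _ _ (m * `|d|)); last by rewrite ler_wpM2l.
  rewrite hS [in X in _ - G X]Ek.
  have [d0|d0] := leP 0 d.
    have := @dominated_derive_le _ _ _ (fun s => G (h k + s *: basis_vec R k))
      (fun s => 'D_(basis_vec R k) G (h k + s *: basis_vec R k))
      (fun s => m * s) (fun _ => m) 0 d d0.
    rewrite mulr0 subr0 ger0_norm//; apply.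
    - move=> t t0d; apply: dG; by rewrite (min_idPl d0) (max_idPr d0).
    - move=> t t0d; apply: (H _ _).2; apply: inb; by rewrite (min_idPl d0) (max_idPr d0).
  have d0' := ltW d0.
  have := @dominated_derive_le _ _ _ (fun s => G (h k + s *: basis_vec R k))
      (fun s => 'D_(basis_vec R k) G (h k + s *: basis_vec R k))
      (fun s => m * s) (fun _ => m) d 0 d0'.
  rewrite mulr0 sub0r ltr0_norm// mulrN distrC; apply.
  - move=> t t0d; apply: dG; by rewrite (min_idPr d0') (max_idPl d0').
  - move=> t t0d; apply: (H _ _).2; apply: inb; by rewrite (min_idPr d0') (max_idPl d0').
have -> : G a - G a' = \sum_(k < n) (G (h k.+1) - G (h k)).
  by rewrite -hn -h0 -(telescope_sumr (fun k => G (h k)) (leq0n n)) big_mkord.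
apply: (le_trans (ler_norm_sum _ _ _)).
rewrite -[X in X%:R]card_ord -sum1_card natr_sum !mulr_suml ler_sum// => k _.
by rewrite mul1r; exact: step.
Qed.

(** This is the Lipschitz bound for [G - dirder G b], whose partials are bounded by [e]. *)
Lemma partials_linearize G b (rho e : R) : 0 <= e -> 0 <= rho ->
  (forall z, `|z - b| <= rho -> has_partials G z /\
     forall i, `|'D_(basis_vec R i) G z - 'D_(basis_vec R i) G b| <= e) ->
  forall a, `|a - b| <= rho ->
    `|G a - G b - dirder G b (a - b)| <= n%:R * e * `|a - b|.
Proof.
move=> e0 r0 H a ab.
have dlin z i : is_derive z (basis_vec R i) (dirder G b) ('D_(basis_vec R i) G b).
  apply/is_derive_mxP => k l.
  rewrite (_ : (fun y => _) =
    \sum_(j < n) ('D_(basis_vec R j) G b k l) *: (fun y : 'cV[R]_n => y j ord0)); last first.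
    apply/funext => y; rewrite /dirder fct_sumE summxE; apply: eq_bigr => j _.
    by rewrite !mxE /= mulrC.
  have dc j : is_derive z (basis_vec R i) (fun y : 'cV[R]_n => y j ord0) (basis_vec R i j ord0).
    by have /is_derive_mxP := is_derive_id z (basis_vec R i); exact.
  apply: is_derive_eq.
  rewrite (bigD1 i)//= big1 ?addr0; last first.
    by move=> j ji; rewrite mxE (negbTE ji) /= scaler0.
  by rewrite mxE !eqxx /GRing.scale/= mulr1.
have bb : `|b - b| <= rho by rewrite subrr normr0.
have := @partials_lipschitz (G - dirder G b) b rho e e0 _ a b ab bb.
rewrite (_ : (G - dirder G b) a - (G - dirder G b) b = G a - G b - dirder G b (a - b)); last first.
  have -> : dirder G b (a - b) = dirder G b a - dirder G b b.
    by rewrite /dirder -sumrB; apply: eq_bigr => i _; rewrite !mxE scalerBl.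
  by rewrite !fctE !opprB addrACA [RHS]addrACA [- _ - G b]addrC.
apply=> z /H [Hz1 Hz2]; split=> i.
  by apply: derivableB; [exact: Hz1|case: (dlin z i)].
rewrite deriveB; [|exact: Hz1|by case: (dlin z i)].
by have [_ ->] := dlin z i; exact: Hz2.
Qed.

Lemma is_derive_along G (gamma : R -> 'cV[R]_n) (t : R) v :
  (\forall z \near gamma t, has_partials G z) ->
  (forall i, {for gamma t, continuous (fun z => 'D_(basis_vec R i) G z)}) ->
  is_derive t 1 gamma v ->
  is_derive t 1 (G \o gamma) (dirder G (gamma t) v).
Proof.
move=> hp cp dg; set b := gamma t.
have dirderB w w' : dirder G b (w - w') = dirder G b w - dirder G b w'.
  rewrite /dirder -sumrB; apply: eq_bigr => i _; by rewrite !mxE scalerBl.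
have dirderZ c w : dirder G b (c *: w) = c *: dirder G b w.
  rewrite /dirder scaler_sumr; apply: eq_bigr => i _; by rewrite !mxE scalerA.
have [D D0 HD] : exists2 D : R, 0 <= D & forall w, `|dirder G b w| <= D * `|w|.
  exists (\sum_(i < n) `|'D_(basis_vec R i) G b|); first by rewrite sumr_ge0.
  move=> w; apply: (le_trans (ler_norm_sum _ _ _)).
  rewrite mulr_suml ler_sum// => i _.
  by rewrite normrZ mulrC ler_wpM2l// mx_entry_le.
apply/is_deriveP => e e0.
(* [e] is halved: [e1] controls the remainder of [gamma] after applying [dirder], [e2] the remainder
   of [G]; [C] bounds the difference quotients of [gamma] near [t]. *)
pose e1 := e / (2 * (D + 1)).
have e10 : 0 < e1 by rewrite divr_gt0// mulr_gt0// ltr_wpDl.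
pose C := `|v| + e1.
have C0 : 0 < C by rewrite ltr_wpDl.
pose e2 := e / (2 * ((n%:R + 1) * C)).
have e20 : 0 < e2 by rewrite divr_gt0// !mulr_gt0// ltr_wpDl.
have : \forall z \near b, has_partials G z /\
   forall i, `|'D_(basis_vec R i) G z - 'D_(basis_vec R i) G b| <= e2.
  have hc1 (i : 'I_n) : nbhs b [set z |
      `|'D_(basis_vec R i) G z - 'D_(basis_vec R i) G b| <= e2].
    have sym (A B : 'M[R]_(p, q)) : `|A - B| <= e2 -> `|B - A| <= e2 by rewrite distrC.
    by move/cvgrPdist_le : (cp i) => /(_ _ e20); apply: filterS => z; exact: sym.
  have hc := @filter_forall _ _ _ _ (nbhs_filter b) hc1.
  by near=> z; split; near: z.
move=> /nbhs_normP[r /= r0 Hr].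
have r20 : 0 < r / 2 by lra.
have rr : forall z, `|z - b| <= r / 2 -> has_partials G z /\
   forall i, `|'D_(basis_vec R i) G z - 'D_(basis_vec R i) G b| <= e2.
  by move=> z zb; apply: Hr; rewrite /ball_/= distrC (le_lt_trans zb)//; lra.
have /is_deriveP /(_ _ e10) := dg.
have hr : 0 < r / 2 / C by rewrite divr_gt0.
have := @nbhs0_le R R _ hr.
apply: filterS2 => h hh dgh.
have gb : `|gamma (t + h) - b| <= C * `|h|.
  rewrite -(subrK (h *: v) (gamma (t + h) - b)).
  apply: (le_trans (ler_normD _ _)); rewrite normrZ /C mulrDl addrC.
  by rewrite [`|h| * _]mulrC lerD2l.
have gr : `|gamma (t + h) - b| <= r / 2.
  by apply: (le_trans gb); rewrite mulrC -ler_pdivlMr.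
have := partials_linearize (ltW e20) (ltW r20) rr gr => lin.
rewrite /comp -/b.
have -> : G (gamma (t + h)) - G b - h *: dirder G b v =
   (G (gamma (t + h)) - G b - dirder G b (gamma (t + h) - b)) +
   dirder G b (gamma (t + h) - b - h *: v).
  by rewrite (dirderB (gamma (t + h) - b)) dirderZ addrA subrK.
apply: (le_trans (ler_normD _ _)).
rewrite (_ : e * `|h| = e / 2 * `|h| + e / 2 * `|h|); last by field.
apply: lerD.
  apply: (le_trans lin); apply: (@le_trans _ _ (n%:R * e2 * (C * `|h|))).
    by rewrite ler_wpM2l// mulr_ge0// ltW.
  rewrite mulrA ler_wpM2r//.
  rewrite (_ : n%:R * e2 * C = n%:R / (n%:R + 1) * (e / 2)); last first.
    rewrite /e2; field; rewrite (gt_eqF C0) /= gt_eqF// ltr_wpDl//.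
  rewrite ler_piMl ?divr_ge0 ?(ltW e0)//.
  by rewrite ler_pdivrMr ?ltr_wpDl// mul1r lerDl.
apply: (le_trans (HD _)); apply: (@le_trans _ _ (D * (e1 * `|h|))).
  by rewrite ler_wpM2l.
rewrite mulrA ler_wpM2r//.
rewrite (_ : D * e1 = D / (D + 1) * (e / 2)); last first.
  by rewrite /e1; field; rewrite gt_eqF// ltr_wpDl.
rewrite ler_piMl ?divr_ge0 ?(ltW e0)//.
by rewrite ler_pdivrMr ?ltr_wpDl// mul1r lerDl.
Unshelve. all: by end_near.
Qed.

End multivariable.

(** * Euclidean norm, distance, tubes around compact sets *)

Section enorm.
Variables (R : realType) (n : nat).
Implicit Types (x y v w : 'cV[R]_n) (A : set 'cV[R]_n).

Lemma enorm_ge0 v : 0 <= enorm v. Proof. exact: sqrtr_ge0. Qed.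

Lemma enorm_sqrE v : enorm v ^+ 2 = (v^T *m v) ord0 ord0.
Proof.
rewrite sqr_sqrtr; last by apply: sumr_ge0 => i _; rewrite sqr_ge0.
by rewrite mxE; apply: eq_bigr => i _; rewrite mxE expr2.
Qed.

Lemma norm_le_enorm v : `|v| <= enorm v.
Proof.
apply/mx_norm_leP; first exact: enorm_ge0.
move=> i j; rewrite (ord1 j) -sqrtr_sqr ler_sqrt.
  rewrite (bigD1 i)//= lerDl; apply: sumr_ge0 => k _; exact: sqr_ge0.
by apply: sumr_ge0 => k _; exact: sqr_ge0.
Qed.

Lemma enorm_le_norm v : enorm v <= n%:R * `|v|.
Proof.
rewrite -ler_sqr ?nnegrE ?enorm_ge0 ?mulr_ge0// sqr_sqrtr; last first.
  by apply: sumr_ge0 => i _; rewrite sqr_ge0.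
apply: (@le_trans _ _ (n%:R * `|v| ^+ 2)).
  rewrite -[X in X%:R]card_ord -sum1_card natr_sum mulr_suml ler_sum// => k _.
  by rewrite mul1r -real_normK ?num_real// ler_sqr ?nnegrE// mx_entry_le.
rewrite exprMn ler_wpM2r ?sqr_ge0// -natrX ler_nat.
by case: n => // k; rewrite -[X in (X <= _)%N]expn1 leq_pexp2l.
Qed.

(** Pythagoras. It removes an unknown multiple of [f] from an estimate of a vector orthogonal to
    [f]. *)
Lemma enorm_orthogonal_le w f (c : R) : (f^T *m w) ord0 ord0 = 0 ->
  enorm w <= enorm (w + c *: f).
Proof.
move=> fw; rewrite -ler_sqr ?nnegrE ?enorm_ge0// !enorm_sqrE.
have wf : (w^T *m f) ord0 ord0 = 0.
  have -> : w^T *m f = (f^T *m w)^T by rewrite trmx_mul trmxK.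
  by rewrite mxE.
have ED (A B : 'M[R]_1) : (A + B) ord0 ord0 = A ord0 ord0 + B ord0 ord0 by rewrite mxE.
have EZ (k : R) (A : 'M[R]_1) : (k *: A) ord0 ord0 = k * A ord0 ord0 by rewrite mxE.
have -> : (w + c *: f)^T *m (w + c *: f) =
    w^T *m w + c *: (w^T *m f) + c *: (f^T *m w) + (c * c) *: (f^T *m f).
  have -> : (w + c *: f)^T = w^T + c *: f^T by apply/matrixP => i j; rewrite !mxE.
  rewrite mulmxDl !mulmxDr -!scalemxAl -!scalemxAr scalerA.
  by rewrite !addrA.
rewrite !ED !EZ wf fw !mulr0 !addr0 lerDl -enorm_sqrE mulr_ge0//.
  by rewrite -expr2 sqr_ge0.
exact: sqr_ge0.
Qed.

Lemma enorm_gt0 v : v != 0 -> 0 < enorm v.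
Proof. by move=> v0; apply: lt_le_trans (norm_le_enorm v); rewrite normr_gt0. Qed.

Lemma dist_set_le x y A : A y -> dist_set x A <= enorm (x - y).
Proof.
move=> Ay; apply: ge_inf; last by exists y.
by exists 0 => _ [z _ <-]; exact: enorm_ge0.
Qed.

Lemma dist_set_ge0 x A : 0 <= dist_set x A.
Proof.
(* [inf] of the empty set is 0, so the bound survives for empty [A]. *)
have [->|/set0P[y Ay]] := eqVneq A set0; first by rewrite /dist_set image_set0 inf0.
apply: lb_le_inf; first by exists (enorm (x - y)), y.
by move=> _ [z _ <-]; exact: enorm_ge0.
Qed.

Lemma dist_set_ltP x A (r : R) : A !=set0 -> dist_set x A < r ->
  exists2 y, A y & enorm (x - y) < r.
Proof.
move=> [y0 Ay0] h.
have e0 : 0 < r - dist_set x A by rewrite subr_gt0.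
have hi : has_inf [set enorm (x - y) | y in A].
  split; first by exists (enorm (x - y0)), y0.
  by exists 0 => _ [z _ <-]; exact: enorm_ge0.
have [_ [y Ay <-] hy] := inf_adherent e0 hi.
exists y => //; apply: (lt_le_trans hy).
by rewrite -[X in X + _]/(dist_set x A) addrC subrK.
Qed.

End enorm.

Lemma near_normP (R : realType) (V : normedModType R) (p : V) (P : V -> Prop) :
  (\forall y \near p, P y) <-> exists2 r : R, 0 < r & forall y, `|y - p| < r -> P y.
Proof.
split=> [/nbhs_normP[r /= r0 Hr]|[r r0 Hr]].
  by exists r => // y yp; apply: Hr; rewrite /ball_/= distrC.
by apply/nbhs_normP; exists r => // y; rewrite /ball_/= distrC; exact: Hr.
Qed.

Lemma continuous_atP (R : realType) (V W : normedModType R) (g : V -> W) (x : V) :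
  {for x, continuous g} <->
  forall e : R, 0 < e -> exists2 d : R, 0 < d & forall y, `|y - x| < d -> `|g y - g x| <= e.
Proof.
split=> [/cvgrPdist_le H e e0|H].
  by have /near_normP[d d0 Hd] := H e e0; exists d => // y yx; rewrite distrC; exact: Hd.
apply/cvgrPdist_le => e e0; apply/near_normP; have [d d0 Hd] := H e e0.
by exists d => // y yx; rewrite distrC; exact: Hd.
Qed.

Section tubes.
Variables (R : realType) (n : nat).

(** A Lebesgue number argument, turning a property that is local at each point of [K] into one with
    a uniform radius. *)
Lemma compact_tube (K : set 'cV[R]_n) (P : 'cV[R]_n -> Prop) : compact K ->
  (forall p, K p -> \forall y \near p, P y) ->
  exists2 d : R, 0 < d & forall p y, K p -> `|y - p| < d -> P y.
Proof.
move=> /compact_near_coveringP cK H.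
pose Q (d : R) (p : 'cV[R]_n) := forall y, `|y - p| < d -> P y.
have : \forall d \near (0 : R)^'+, K `<=` Q d.
  apply: cK => p Kp; have /near_normP[r r0 Hr] := H p Kp.
  (* Half the radius, so that points within [r / 2] of a centre [p'] near [p] are still within [r]
     of [p]. *)
  have r2 : 0 < r / 2 by lra.
  exists ([set y | `|y - p| < r / 2], [set d | d < r / 2]).
    split => /=; last exact: nbhs_right_lt.
    by apply: (iffRL (near_normP (p : 'cV[R]_n) _)); exists (r / 2).
  move=> [p' d] /= [pp' dr] y yp'; apply: Hr.
  rewrite -(subrK p' y) -addrA; apply: (le_lt_trans (ler_normD _ _)); lra.
move=> h.
have : \forall d \near (0 : R)^'+, 0 < d /\ K `<=` Q d.
  by near=> d; split; near: d; [exact: nbhs_right_gt|exact: h].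
move=> /filter_ex[d [d0 Kd]].
by exists d => // p y Kp; exact: Kd.
Unshelve. all: by end_near.
Qed.

(** First a bound on [K] by compactness, then one on a tube at the cost of adding 1. *)
Lemma compact_tube_bounded (V : normedModType R) (K : set 'cV[R]_n)
    (g : 'cV[R]_n -> V) : compact K ->
  (forall p, K p -> {for p, continuous g}) ->
  exists2 d : R, 0 < d &
    exists2 C : R, 0 < C & forall p y, K p -> `|y - p| < d -> `|g y| <= C.
Proof.
move=> cK cg.
have /compact_near_coveringP cK' := cK.
pose Q (C : R) (p : 'cV[R]_n) := `|g p| <= C.
have : \forall C \near +oo, K `<=` Q C.
  apply: cK' => p Kp.
  exists ([set y | `|g p - g y| <= 1], [set C | `|g p| + 1 <= C]).
    split=> /=; last exact: nbhs_pinfty_ge.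
    by have /cvgrPdist_le := cg p Kp; apply.
  move=> [y C] /= [gy gC]; apply: le_trans gC.
  rewrite -(subrK (g p) (g y)) addrC; apply: (le_trans (ler_normD _ _)).
  by rewrite lerD2l distrC.
move=> h.
have : \forall C \near +oo, 0 < C /\ K `<=` Q C.
  by near=> C; split; near: C; [exact: nbhs_pinfty_gt|exact: h].
move=> /filter_ex[C [C0 KC]].
have [|d d0 Hd] := @compact_tube K (fun y => `|g y| <= C + 1) cK.
  move=> p Kp; have /cvgrPdist_le /(_ _ ltr01) := cg p Kp.
  apply: filterS => y gy; rewrite -(subrK (g p) (g y)) addrC.
  apply: (le_trans (ler_normD _ _)); rewrite lerD//; first exact: KC.
  by rewrite distrC.
by exists d => //; exists (C + 1) => //; rewrite addr_gt0.
Unshelve. all: by end_near.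
Qed.

Lemma dist_set_lt_tube (K : set 'cV[R]_n) (d : R) y : K !=set0 -> dist_set y K < d ->
  exists2 p, K p & `|y - p| < d.
Proof.
move=> K0 /(dist_set_ltP K0)[p Kp h]; exists p => //.
exact: le_lt_trans (norm_le_enorm _) h.
Qed.

End tubes.

Lemma Ck_has_partials (R : realType) (n p q k : nat) (U : set 'cV[R]_n)
    (G : 'cV[R]_n -> 'M[R]_(p, q)) : Ck k.+1 U G ->
  forall x, U x -> has_partials G x.
Proof. by move=> [_ H] x Ux i; exact: (H i).1. Qed.

Lemma Ck_continuous (R : realType) (n k : nat) (V : normedModType R)
    (U : set 'cV[R]_n) (G : 'cV[R]_n -> V) : Ck k U G ->
  forall x, U x -> {for x, continuous G}.
Proof. by case: k => [|k] [H _] x Ux; exact: H. Qed.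

Lemma Ck_partials_continuous (R : realType) (n k : nat) (V : normedModType R)
    (U : set 'cV[R]_n) (G : 'cV[R]_n -> V) : Ck k.+1 U G ->
  forall x i, U x -> {for x, continuous (fun z => 'D_(basis_vec R i) G z)}.
Proof. by move=> [_ H] x i Ux; exact: (Ck_continuous (H i).2). Qed.

(** * Uniform second-order estimates near compact sets *)

Section jacobian.
Variables (R : realType) (n : nat) (f : 'cV[R]_n -> 'cV[R]_n).

Lemma jacobian_mxE x i j : has_partials f x ->
  jacobian_mx f x i j = ('D_(basis_vec R j) f x) i ord0.
Proof. by move=> pf; rewrite mxE derive_mx ?mxE//; exact: pf. Qed.

Lemma dirder_jacobian x v : has_partials f x ->
  dirder f x v = jacobian_mx f x *m v.
Proof.
move=> pf; apply/matrixP => i j; rewrite (ord1 j) summxE mxE.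
by apply: eq_bigr => k _; rewrite jacobian_mxE// mxE mulrC.
Qed.

(** Compactness bounds the first and second partials on a tube. Mean value estimates turn this into
    Lipschitz bounds for [f] and its Jacobian, and linearisation on the ball of radius [|a - p|]
    gives the quadratic Taylor remainder. *)
Lemma C2_tube (K : set 'cV[R]_n) : compact K -> Ck 2 setT f ->
  exists2 d : R, 0 < d & exists2 L : R, 0 < L & forall p, K p ->
    [/\ forall a b, `|a - p| <= d -> `|b - p| <= d -> `|f a - f b| <= L * `|a - b|,
        forall a b, `|a - p| <= d -> `|b - p| <= d ->
          `|jacobian_mx f a - jacobian_mx f b| <= L * `|a - b|,
        forall a, `|a - p| <= d -> `|jacobian_mx f a| <= L
      & forall a, `|a - p| <= d ->
          `|f a - f p - jacobian_mx f p *m (a - p)| <= L * `|a - p| ^+ 2].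
Proof.
move=> cK cf; have n0 := ler0n R n.
have pf x : has_partials f x by exact: (Ck_has_partials cf).
have c2 i : Ck 1 setT (fun x => 'D_(basis_vec R i) f x) by exact: (cf.2 i).2.
have bd (g : 'cV[R]_n -> 'cV[R]_n) : continuous g ->
  exists2 dC : R * R, 0 < dC.1 & 0 < dC.2 /\ forall p y, K p -> `|y - p| < dC.1 -> `|g y| <= dC.2.
  move=> cg; have [d d0 [C C0 H]] := @compact_tube_bounded _ _ _ K g cK (fun p _ => cg p).
  by exists (d, C).
have bd2 (I : finType) (g : I -> 'cV[R]_n -> 'cV[R]_n) : (forall i, continuous (g i)) ->
  exists2 d : R, 0 < d & exists2 C : R, 0 < C & forall i p y, K p -> `|y - p| < d -> `|g i y| <= C.
  move=> cg; have /choice[dC HdC] : forall i, exists dC : R * R, 0 < dC.1 /\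
      0 < dC.2 /\ forall p y, K p -> `|y - p| < dC.1 -> `|g i y| <= dC.2.
    by move=> i; have [dC ? ?] := bd _ (cg i); exists dC.
  exists (\big[Num.min/1]_(i : I) (dC i).1).
    by apply: lt_bigmin => // i _; exact: (HdC i).1.
  exists (\big[Num.max/1]_(i : I) (dC i).2).
    by apply: lt_le_trans (bigmax_ge_id _ _ _ _).
  move=> i p y Kp yp; apply: le_trans (le_bigmax _ _ i).
  apply: (HdC i).2.2 Kp _; apply: (lt_le_trans yp); exact: bigmin_le.
have cD1 i : continuous (fun x => 'D_(basis_vec R i) f x).
  by move=> x; exact: (Ck_partials_continuous cf).
have cD2 (ij : 'I_n * 'I_n) :
    continuous (fun x => 'D_(basis_vec R ij.2) (fun x => 'D_(basis_vec R ij.1) f x) x).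
  by move=> x; exact: (Ck_partials_continuous (c2 ij.1)).
have [d1 d10 [C1 C10 H1]] := bd2 _ _ cD1.
have [d2 d20 [C2 C20 H2]] := bd2 _ _ cD2.
pose d := Num.min d1 d2 / 2.
have d0 : 0 < d by rewrite divr_gt0// lt_min d10.
have dd1 : d < d1.
  have : Num.min d1 d2 <= d1 by rewrite ge_min lexx.
  by rewrite /d; lra.
have dd2 : d < d2.
  have : Num.min d1 d2 <= d2 by rewrite ge_min lexx orbT.
  by rewrite /d; lra.
pose L := C1 + (n%:R * C1 + n%:R * C2 + n%:R * (n%:R * C2)).
have nC1 : 0 <= n%:R * C1 by rewrite mulr_ge0// ltW.
have nC2 : 0 <= n%:R * C2 by rewrite mulr_ge0// ltW.
have nnC2 : 0 <= n%:R * (n%:R * C2) by rewrite mulr_ge0.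
exists d => //; exists L; first by rewrite /L; lra.
move=> p Kp.
have lipD i a b : `|a - p| <= d -> `|b - p| <= d ->
    `|'D_(basis_vec R i) f a - 'D_(basis_vec R i) f b| <= n%:R * C2 * `|a - b|.
  apply: (@partials_lipschitz R n n 1 (fun z => 'D_(basis_vec R i) f z) p d); first exact: ltW.
  move=> z zp; split; first exact: (Ck_has_partials (c2 i)).
  by move=> j; apply: (H2 (i, j) p z Kp); exact: le_lt_trans dd2.
split.
- move=> a b ap bp; apply: (@le_trans _ _ (n%:R * C1 * `|a - b|)); last first.
    by rewrite ler_wpM2r// /L; lra.
  apply: (@partials_lipschitz R n n 1 f p d) => //; first exact: ltW.
  move=> z zp; split => // i; apply: H1 Kp _; exact: le_lt_trans dd1.
- move=> a b ap bp; apply/mx_norm_leP; first by rewrite mulr_ge0// /L; lra.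
  move=> i j; rewrite mxE [X in _ + X]mxE !jacobian_mxE//.
  have := le_trans (mx_entry_le _ i ord0) (lipD j a b ap bp); rewrite !mxE => h.
  by apply: (le_trans h); rewrite ler_wpM2r// /L; lra.
- move=> a ap; apply/mx_norm_leP; first by rewrite /L; lra.
  move=> i j; rewrite jacobian_mxE//; apply: (le_trans (mx_entry_le _ _ _)).
  apply: (le_trans (H1 j p a Kp (le_lt_trans ap dd1))); rewrite /L; lra.
- move=> a ap; rewrite -dirder_jacobian//.
  apply: (@le_trans _ _ (n%:R * (n%:R * C2 * `|a - p|) * `|a - p|)); last first.
    by rewrite expr2 !mulrA ler_wpM2r// ler_wpM2r// /L -mulrA; lra.
  apply: (@partials_linearize R n n 1 f p `|a - p|) => //.
    by rewrite mulr_ge0// mulr_ge0// ltW.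
  move=> z zp; split => // i; apply: (le_trans (lipD i z p (le_trans zp ap) _)).
    by rewrite subrr normr0 ltW.
  by rewrite ler_wpM2l// mulr_ge0// ltW.
Qed.

End jacobian.

(** * Openness of the basin of attraction *)

Lemma is_derive_shift_time (R : realType) (W : normedModType R) (phi : R -> W)
    (c t : R) (v : W) :
  is_derive (c + t) 1 phi v -> is_derive t 1 (fun s => phi (c + s)) v.
Proof.
move=> /is_deriveP H; apply/is_deriveP => e e0.
by apply: filterS (H e e0) => h; rewrite addrA.
Qed.

Lemma forward_solution_shift (R : realType) (n : nat) (f : 'cV[R]_n -> 'cV[R]_n)
    x phi (c : R) : 0 <= c -> forward_solution f x phi ->
  forward_solution f (phi c) (fun s => phi (c + s)).
Proof.
move=> c0 [_ dphi]; split; first by rewrite addr0.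
by move=> t t0; apply: is_derive_shift_time; apply: dphi; rewrite addr_ge0.
Qed.

(** At the junction the two pieces have the same value and slope, so the first-order estimate holds
    whichever piece is evaluated. *)
Lemma forward_solution_cat (R : realType) (n : nat) (f : 'cV[R]_n -> 'cV[R]_n)
    (psi chi : R -> 'cV[R]_n) (t0 : R) : 0 <= t0 ->
  (forall t, 0 <= t <= t0 -> is_derive t 1 psi (f (psi t))) ->
  forward_solution f (psi t0) chi ->
  forward_solution f (psi 0) (fun t => if t <= t0 then psi t else chi (t - t0)).
Proof.
move=> t00 dpsi [chi0 dchi]; split; first by rewrite t00.
move=> t t_ge0; apply/is_deriveP => e e0 /=.
have dchi' : t0 <= t -> is_derive t 1 (fun t => chi (t - t0)) (f (chi (t - t0))).
  move=> tt; rewrite (_ : (fun t => chi (t - t0)) = fun t => chi (- t0 + t)); last first.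
    by apply/funext => s; rewrite addrC.
  by apply: is_derive_shift_time; rewrite addrC; apply: dchi; rewrite subr_ge0.
have [tt|tt] := ltP t t0.
  rewrite (ltW tt); have /dpsi/is_deriveP/(_ e e0) : 0 <= t <= t0 by rewrite t_ge0 ltW.
  have : 0 < t0 - t by rewrite subr_gt0.
  move=> /(@nbhs0_le R R).
  apply: filterS2 => h hh.
  have -> : t + h <= t0 by move: hh; rewrite ler_norml; lra.
  by [].
have /is_deriveP/(_ e e0) := dchi' tt.
have [tt'|tt'] := ltP t0 t.
  have : 0 < (t - t0) / 2 by lra.
  move=> /(@nbhs0_le R R).
  apply: filterS2 => h hh.
  have -> : (t + h <= t0) = false by apply/negbTE; rewrite -ltNge; move: hh; rewrite ler_norml; lra.
  by [].
have Et : t = t0 by apply/eqP; rewrite eq_le tt tt'.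
have /dpsi/is_deriveP/(_ e e0) : 0 <= t <= t0 by rewrite t_ge0.
apply: filterS2 => h /=.
rewrite Et subrr chi0 => h1 h2.
by case: ifP => _; [exact: h1|exact: h2].
Qed.

Section basin.
Variables (R : realType) (n : nat) (f : 'cV[R]_n -> 'cV[R]_n) (Omega : set 'cV[R]_n).

Lemma dist_to0_shift (phi : R -> 'cV[R]_n) (c : R) : 0 <= c ->
  dist_set (phi t) Omega @[t --> +oo] --> (0 : R) ->
  dist_set (phi (c + t)) Omega @[t --> +oo] --> (0 : R).
Proof.
move=> c0 /cvgrPdist_le H; apply/cvgrPdist_le => e e0.
have [A [Ar HA]] := H e e0; exists A; split => // t At.
by apply: HA; rewrite (lt_le_trans At)// lerDr.
Qed.

Lemma basin_orbit x phi : forward_solution f x phi ->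
  dist_set (phi t) Omega @[t --> +oo] --> (0 : R) ->
  forall t, 0 <= t -> basin f Omega (phi t).
Proof.
move=> fphi dphi t t0; exists (fun s => phi (t + s)).
  exact: (forward_solution_shift t0 fphi).
exact: dist_to0_shift.
Qed.

Lemma dist_to0_eventually (phi : R -> 'cV[R]_n) (d : R) : 0 < d ->
  dist_set (phi t) Omega @[t --> +oo] --> (0 : R) ->
  exists2 t0 : R, 0 <= t0 & forall t, t0 <= t -> dist_set (phi t) Omega < d.
Proof.
move=> d0 /cvgrPdist_lt /(_ _ d0)[A [_ HA]].
exists (Num.max 0 (A + 1)); first by rewrite le_max lexx.
move=> t; rewrite ge_max => /andP[t0 At].
have : A < t by rewrite (lt_le_trans _ At)// ltrDl.
move=> /HA; rewrite sub0r normrN; apply: le_lt_trans; exact: ler_norm.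
Qed.

Lemma stable_dist_to0 (phi : R -> 'cV[R]_n) (C mu : R) : 0 <= C -> 0 < mu ->
  (forall t, 0 <= t -> dist_set (phi t) Omega <= C * expR (- (mu * t))) ->
  dist_set (phi t) Omega @[t --> +oo] --> (0 : R).
Proof.
move=> C0 mu0 H; apply/cvgrPdist_le => e e0.
(* Beyond this time [C <= e mu t <= e exp (mu t)]. *)
exists (Num.max 0 (C / (mu * e))); split; first exact: num_real.
move=> t; rewrite gt_max => /andP[t0 Ct].
rewrite sub0r normrN ger0_norm ?dist_set_ge0//.
apply: (le_trans (H t (ltW t0))).
rewrite expRN ler_pdivrMr ?expR_gt0//.
apply: (@le_trans _ _ (e * (mu * t))).
  move: Ct; rewrite ltr_pdivrMr ?mulr_gt0// => /ltW; rewrite mulrC.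
  by rewrite [mu * e]mulrC mulrA.
rewrite ler_wpM2l ?(ltW e0)//; apply: le_trans (expR_ge1Dx _).
by rewrite lerDr.
Qed.

Hypothesis cf : Ck 2 setT f.
Hypothesis Omega0 : Omega !=set0.
Hypothesis stableO : exponentially_stable f Omega.

Let clamp (r : R) (u : 'cV[R]_n) : 'cV[R]_n :=
  \col_i Num.max (- r) (Num.min (u i ord0) r).

Let clamp_lip r u v : `|clamp r u - clamp r v| <= `|u - v|.
Proof.
apply/mx_norm_leP => // i j; rewrite !mxE.
have := mx_entry_le (u - v) i ord0; rewrite !mxE; apply: le_trans.
rewrite /Num.max /Num.min ler_norml.
have := ler_norm (u i ord0 - v i ord0).
have := ler_norm (- (u i ord0 - v i ord0)); rewrite normrN.
do 4 (case: ifPn; rewrite -?leNgt); lra.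
Qed.

Let clamp_le r u : 0 <= r -> `|clamp r u| <= r.
Proof.
move=> r0; apply/mx_norm_leP => // i j; rewrite !mxE ler_norml.
by rewrite le_max lexx /= ge_max ge_min lexx orbT andbT; lra.
Qed.

Let clamp_id r u : `|u| <= r -> clamp r u = u.
Proof.
move=> ur; apply/matrixP => i j; rewrite (ord1 j) !mxE.
have := le_trans (mx_entry_le u i ord0) ur; rewrite ler_norml => /andP[u1 u2].
by rewrite (min_idPl u2) (max_idPr u1).
Qed.

Let clamp0 r : 0 <= r -> clamp r 0 = 0.
Proof. by move=> r0; apply: clamp_id; rewrite normr0. Qed.

(* The perturbation [u = psi - phi] of a solution [phi] is built by solving
   [u' = f (phi + clamp u) - f phi], whose right-hand side is globally
   Lipschitz; Gronwall shows that the truncation is inactive for small [u 0]. *)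
Lemma solution_perturbation x phi (t0 e : R) : forward_solution f x phi ->
  0 <= t0 -> 0 < e ->
  \forall y \near x, exists psi : R -> 'cV[R]_n,
    [/\ psi 0 = y, forall t, 0 <= t <= t0 -> is_derive t 1 psi (f (psi t))
      & forall t, 0 <= t <= t0 -> `|psi t - phi t| <= e].
Proof.
move=> [phi0 dphi] t00 e0.
(* Time is frozen outside [[0, t0]], which makes the reference curve continuous on [R] with values
   in a compact set. *)
pose c (t : R) := Num.min (Num.max t 0) t0.
have cc : continuous c.
  move=> t; apply: (@continuous_min R R (fun t => Num.max t 0) (cst t0)).
    exact: max0_continuous.
  exact: cvg_cst.
have c01 t : 0 <= c t <= t0 by rewrite /c le_min le_max lexx orbT t00 /= ge_min lexx orbT.
have cid t : 0 <= t <= t0 -> c t = t.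
  by move=> /andP[? ?]; rewrite /c (max_idPl _)// (min_idPl _).
have cphi : continuous (phi \o c).
  move=> t; apply: continuous_comp; first exact: cc.
  by apply: is_derive_continuous (dphi _ _); case/andP: (c01 t).
pose K := [set phi t | t in `[0, t0]].
have Kphi t : K (phi (c t)) by exists (c t) => //=; rewrite in_itv/=.
have cK : compact K.
  have -> : K = (phi \o c) @` `[0, t0].
    apply/seteqP; split=> [_ [t tt <-]|_ [t tt <-]] /=; last exact: Kphi.
    by exists t => //; move: tt; rewrite /= in_itv /= => tt; rewrite cid.
  apply: continuous_compact; last exact: segment_compact.
  exact: continuous_subspaceT.
have [d d0 [L L0 HK]] := C2_tube cK cf.
have fc : continuous f by move=> z; exact: (Ck_continuous cf).
pose F t u := f (phi (c t) + clamp d u) - f (phi (c t)).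
have Flip t a b : `|F t a - F t b| <= L * `|a - b|.
  rewrite /F opprB addrA subrK.
  have [Hl _ _ _] := HK _ (Kphi t).
  apply: (le_trans (Hl _ _ _ _)).
  - by rewrite addrC addKr; apply: clamp_le; exact: ltW.
  - by rewrite addrC addKr; apply: clamp_le; exact: ltW.
  rewrite opprD addrACA subrr add0r ler_wpM2l ?(ltW L0)//; exact: clamp_lip.
have Fcont (u : R -> 'cV[R]_n) : continuous u -> continuous (fun t => F t (u t)).
  move=> cu t.
  have clc : continuous (clamp d).
    move=> z; apply/(@continuous_atP R 'cV[R]_n 'cV[R]_n) => h h0; exists h => // y yz.
    by apply: (le_trans (clamp_lip _ _ _)); exact: ltW.
  have c1 : {for t, continuous (fun t => phi (c t) + clamp d (u t))}.
    apply: cvgD; first exact: cphi.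
    have c2 : {for t, continuous (clamp d \o u)}.
      apply: continuous_comp; [exact: cu|exact: clc].
    exact: c2.
  have c3 : {for t, continuous (f \o (fun t => phi (c t) + clamp d (u t)))}.
    apply: continuous_comp => //; exact: fc.
  have c4 : {for t, continuous (f \o (phi \o c))}.
    apply: continuous_comp; [exact: cphi|exact: fc].
  exact: (cvgB c3 c4).
have F0 t : F t 0 = 0 by rewrite /F clamp0 ?(ltW d0)// addr0 subrr.
have [C C0 HC] := @gronwall R n t0 L t00 (ltW L0).
(* Gronwall gives [|u t| <= C |y - x|]: up to [d] the truncation is inactive, up to [e] the
   perturbation is close enough. *)
pose r := Num.min d e / C.
have r0 : 0 < r by rewrite divr_gt0// lt_min d0.
apply/near_normP; exists r => // y yx.
have [u u0 du] := @picard R n F (y - x)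
   (fun tau _ => ex_intro2 _ _ L (ltW L0) (fun t a b _ => Flip t a b)) Fcont.
have ule t : 0 <= t <= t0 -> `|u t| <= Num.min d e.
  move=> tt; apply: (le_trans (HC u (fun t => F t (u t)) 0 (lexx 0) _ _ t tt)).
  - by move=> s /andP[s0 _]; exact: du.
  - by move=> s _; have := Flip s (u s) 0; rewrite F0 !subr0 addr0.
  by rewrite addr0 u0 mulrC -ler_pdivlMr// ltW.
exists (fun t => phi t + u t); split.
- by rewrite phi0 u0 addrC subrK.
- move=> t tt; have /andP[t_ge0 _] := tt.
  have := du t t_ge0; rewrite /F cid// clamp_id; last first.
    by apply: (le_trans (ule t tt)); rewrite ge_min lexx.
  move=> dut; have := dphi t t_ge0 => dphit.
  rewrite (_ : (fun t => _) = phi + u); last by apply/funext.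
  have E (a b : 'cV[R]_n) : a + (b - a) = b by rewrite addrC subrK.
  rewrite -[X in is_derive _ _ _ X](E (f (phi t))).
  exact: is_deriveD.
- move=> t tt; rewrite addrC addKr; apply: (le_trans (ule t tt)).
  by rewrite ge_min lexx orbT.
Qed.

(** Follow the given trajectory until it is well inside the stability neighbourhood of [Omega];
    solutions starting nearby are in that neighbourhood at the same time, and exponential stability
    supplies the rest of their trajectories. *)
Lemma basin_open x : basin f Omega x -> \forall y \near x, basin f Omega y.
Proof.
move=> [phi fphi dphi].
have [delta [K [mu [delta0 K0 mu0 st]]]] := stableO.
have n1 : 0 < n%:R + 1 :> R by rewrite ltr_wpDl.
(* At time [t0] the perturbed point is within [2 e] of [Omega] in the sup norm; the factor [n + 1]
   pays for the passage to the Euclidean norm. *)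
pose e := delta / (2 * (n%:R + 1)).
have e0 : 0 < e by rewrite divr_gt0// mulr_gt0.
have [t0 t00 Ht0] := dist_to0_eventually e0 dphi.
have := solution_perturbation fphi t00 e0.
apply: filterS => y [psi [psi0 dpsi psile]].
have tt : 0 <= t0 <= t0 by rewrite t00 lexx.
have [q Oq qe] := dist_set_lt_tube Omega0 (Ht0 t0 (lexx t0)).
have psid : dist_set (psi t0) Omega < delta.
  apply: (le_lt_trans (dist_set_le _ Oq)); apply: (le_lt_trans (enorm_le_norm _)).
  have : `|psi t0 - q| <= 2 * e.
    rewrite -(subrK (phi t0) (psi t0)) -addrA; apply: (le_trans (ler_normD _ _)).
    have := psile t0 tt; lra.
  move=> h; apply: (@le_lt_trans _ _ (n%:R * (2 * e))); first by rewrite ler_wpM2l.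
  rewrite (_ : n%:R * (2 * e) = n%:R / (n%:R + 1) * delta); last first.
    by rewrite /e; field; rewrite gt_eqF.
  rewrite gtr_pMl// ltr_pdivrMr// mul1r ltrDl//.
have [chi fchi dchi] := st _ psid.
have dchi0 : dist_set (chi t) Omega @[t --> +oo] --> (0 : R).
  apply: (@stable_dist_to0 chi (K * dist_set (psi t0) Omega) mu) => //.
    by rewrite mulr_ge0 ?dist_set_ge0// ltW.
  by move=> t t_ge0; rewrite mulrAC; exact: dchi.
have := forward_solution_cat t00 dpsi fchi; rewrite psi0 => fth.
exists (fun t => if t <= t0 then psi t else chi (t - t0)) => //.
move/cvgrPdist_le : dchi0 => H; apply/cvgrPdist_le => h h0.
have [A [Ar HA]] := H h h0.
exists (Num.max t0 (A + t0)); split; first exact: num_real.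
move=> t; rewrite gt_max => /andP[t0t At].
rewrite [t <= t0]leNgt t0t /=; apply: HA; lra.
Qed.

End basin.

(** * Periodic orbits *)

Lemma compact_curve (R : realType) (n : nat) (phi : R -> 'cV[R]_n) (a b : R) :
  (forall t, a <= t <= b -> {for t, continuous phi}) -> compact (phi @` `[a, b]).
Proof.
move=> cphi; apply: continuous_compact; last exact: segment_compact.
apply: continuous_in_subspaceT => t; rewrite inE/= in_itv/=; exact: cphi.
Qed.

Lemma derive0_constant (R : realType) (m n : nat) (phi : R -> 'M[R]_(m, n)) (a b : R) :
  a <= b -> (forall t, a <= t <= b -> is_derive t 1 phi 0) -> phi b = phi a.
Proof.
move=> ab dphi; apply/eqP; rewrite -subr_eq0 -normr_le0.
have := @dominated_derive_le _ _ _ phi (fun=> 0) (cst (0 : R)) (fun=> 0) a b ab dphi.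
by rewrite /= subrr; apply=> t _; rewrite ?normr0//; exact: is_derive_cst.
Qed.

Section flow.
Variables (R : realType) (n : nat) (f : 'cV[R]_n -> 'cV[R]_n).
Hypothesis cf : Ck 2 setT f.

Lemma vector_field_continuous : continuous f.
Proof. by move=> z; exact: (Ck_continuous cf). Qed.

Lemma is_derive_vector_field (phi : R -> 'cV[R]_n) (t : R) v : is_derive t 1 phi v ->
  is_derive t 1 (f \o phi) (jacobian_mx f (phi t) *m v).
Proof.
move=> dphi; rewrite -dirder_jacobian; last exact: (Ck_has_partials cf).
apply: is_derive_along dphi; last by move=> i; exact: (Ck_partials_continuous cf).
by apply/near_normP; exists 1 => // z _; exact: (Ck_has_partials cf).
Qed.

(** [f] along [phi] solves a linear homogeneous equation, so by Gronwall it stays zero and [phi] has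
    zero derivative. *)
Lemma forward_equilibrium x phi : forward_solution f x phi -> f x = 0 ->
  forall t, 0 <= t -> phi t = x.
Proof.
move=> [phi0 dphi] fx0 t t0.
have cK : compact (phi @` `[0, t]).
  apply: compact_curve => s /andP[s0 _]; exact: is_derive_continuous (dphi s s0).
have [d d0 [L L0 HK]] := C2_tube cK cf.
have nL : 0 <= n%:R * L by rewrite mulr_ge0// ltW.
have [C C0 HC] := @gronwall R n t (n%:R * L) t0 nL.
have f0 s : 0 <= s <= t -> f (phi s) = 0.
  move=> st; apply/eqP; rewrite -normr_le0.
  have := HC (f \o phi) (fun s => jacobian_mx f (phi s) *m f (phi s)) 0 (lexx 0).
  rewrite /= phi0 fx0 normr0 addr0 mulr0; apply=> //.
    by move=> u /andP[u0 _]; apply: is_derive_vector_field; exact: dphi.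
  move=> u ut; rewrite addr0; apply: (le_trans (mulmx_norm_le _ _)).
  rewrite mulrA ler_wpM2r// ler_wpM2l//.
  have [|_ _ H _] := HK (phi u); first by exists u => //; rewrite /= in_itv.
  by apply: H; rewrite subrr normr0 ltW.
rewrite -phi0; apply: derive0_constant t0 _ => s st; rewrite -(f0 s st).
by apply: dphi; case/andP: st.
Qed.

(** The point [a] is close to some [p'] in [K] but is compared with an arbitrary [p] in [K]. This
    allows a solution in the tube to be compared with the orbit point of the same time before the
    two are known to be close. *)
Lemma C2_tube_global (K : set 'cV[R]_n) : compact K ->
  exists2 d : R, 0 < d & exists2 L : R, 0 < L & forall p p' a, K p -> K p' ->
    `|a - p'| < d ->
    [/\ `|f a - f p| <= L * `|a - p|,
        `|jacobian_mx f a - jacobian_mx f p| <= L * `|a - p|,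
        `|jacobian_mx f a| <= L
      & `|f a - f p - jacobian_mx f p *m (a - p)| <= L * `|a - p| ^+ 2].
Proof.
move=> cK; have [d1 d10 [L L0 HL]] := C2_tube cK cf.
have [d2 d20 [F F0 HF]] := @compact_tube_bounded _ _ _ K f cK
  (fun p _ => @vector_field_continuous p).
pose d := Num.min d1 d2; have d0 : 0 < d by rewrite lt_min d10.
have d_neq0 : d != 0 by rewrite gt_eqF.
have nL : 0 <= n%:R * L by rewrite mulr_ge0// ltW.
have Fd : 0 < F / d by rewrite divr_gt0.
have Ld : 0 < L / d by rewrite divr_gt0.
have Fdd : 0 < F / d / d by rewrite divr_gt0.
have nLd : 0 <= n%:R * L / d by rewrite divr_ge0// ltW.
exists d => //; exists (L + 2 * (F / d) + 2 * (L / d) + 2 * (F / d / d) + n%:R * L / d).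
  by lra.
move=> p p' a Kp Kp' ap'.
have ap'1 : `|a - p'| <= d1 by rewrite ltW// (lt_le_trans ap')// ge_min lexx.
have ap'2 : `|a - p'| < d2 by rewrite (lt_le_trans ap')// ge_min lexx orbT.
have [_ _ /(_ a ap'1) Ja _] := HL p' Kp'.
have [H1 H2 H3 H4] := HL p Kp.
have pp : `|p - p| <= d1 by rewrite subrr normr0 ltW.
have Jp := H3 p pp.
have Fa := HF _ _ Kp' ap'2.
have Fp : `|f p| <= F by apply: (HF p p Kp); rewrite subrr normr0.
have fafp : `|f a - f p| <= 2 * F by apply: (le_trans (ler_normB _ _)); lra.
have JaJp : `|jacobian_mx f a - jacobian_mx f p| <= 2 * L.
  by apply: (le_trans (ler_normB _ _)); lra.
have ap0 := normr_ge0 (a - p).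
have [ap|ap] := leP `|a - p| d.
  have ap1 : `|a - p| <= d1 by rewrite (le_trans ap)// ge_min lexx.
  split.
  - by apply: (le_trans (H1 a p ap1 pp)); rewrite ler_wpM2r//; lra.
  - by apply: (le_trans (H2 a p ap1 pp)); rewrite ler_wpM2r//; lra.
  - by apply: (le_trans Ja); lra.
  - by apply: (le_trans (H4 a ap1)); rewrite ler_wpM2r ?sqr_ge0//; lra.
(* In the far case [|a - p| / d > 1], so bounded quantities are dominated by multiples of [|a - p|]
   and of its square. *)
have big (c : R) : 0 <= c -> c <= c / d * `|a - p|.
  by move=> c0; rewrite mulrAC ler_pdivlMr// ler_wpM2l// ltW.
split.
- apply: (le_trans fafp); apply: (le_trans (big _ _)); first by lra.
  by rewrite ler_wpM2r// -mulrA; lra.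
- apply: (le_trans JaJp); apply: (le_trans (big _ _)); first by lra.
  by rewrite ler_wpM2r// -mulrA; lra.
- by apply: (le_trans Ja); lra.
- have h1 : 2 * F <= 2 * (F / d / d) * `|a - p| ^+ 2.
    apply: (le_trans (big _ _)); first by lra.
    apply: (@le_trans _ _ (2 * F / d / d * `|a - p| * `|a - p|)).
      by rewrite ler_wpM2r// big// -mulrA; lra.
    by rewrite expr2 !mulrA.
  have h2 : n%:R * L * `|a - p| <= n%:R * L / d * `|a - p| ^+ 2.
    by rewrite expr2 mulrA ler_wpM2r// big.
  have h3 : `|jacobian_mx f p *m (a - p)| <= n%:R * L * `|a - p|.
    apply: (le_trans (mulmx_norm_le _ _)).
    by rewrite mulrA ler_wpM2r// ler_wpM2l.
  apply: (le_trans (ler_normB _ _)).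
  apply: (@le_trans _ _ ((2 * (F / d / d) + n%:R * L / d) * `|a - p| ^+ 2)); first by lra.
  by rewrite ler_wpM2r ?sqr_ge0//; lra.
Qed.

End flow.

Section periodic.
Variables (R : realType) (n : nat) (f : 'cV[R]_n -> 'cV[R]_n).
Hypothesis cf : Ck 2 setT f.
Variables (Omega : set 'cV[R]_n).
Hypothesis perO : periodic_orbit f Omega.

(** Reduction modulo the period gives a compact time interval and, for each orbit point, arbitrarily
    late visits. The latter stand in for backward arguments, as solutions are only compared forward
    in time. *)
Lemma periodic_orbit_param : exists p : R -> 'cV[R]_n,
  (forall t : R, is_derive t 1 p (f (p t))) /\
  exists2 T : R, 0 < T & [/\ forall t s, exists2 u, u >= s & p u = p t,
    Omega = p @` `[0, T], forall t, Omega (p t) & exists t, p t <> p 0].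
Proof.
have [p [T [dp [T0 pT] nc OE]]] := perO.
exists p; split => //; exists T => //.
have pk t (k : nat) : p (t + k%:R * T) = p t.
  elim: k => [|k IH]; first by rewrite mul0r addr0.
  by rewrite -[k.+1]addn1 natrD mulrDl mul1r addrA pT.
have pz t (m : int) : p (t + m%:~R * T) = p t.
  case: m => k; first exact: pk.
  by rewrite NegzE mulrNz -(pk (t + _) k.+1) mulNr subrK.
split=> //; last by move=> t; rewrite OE; exists t.
  move=> t s; exists (t + (Num.floor ((s - t) / T) + 1)%:~R * T); last exact: pz.
  have := floorD1_gt ((s - t) / T).
  rewrite ltr_pdivrMr// => h; lra.
rewrite OE; apply/seteqP; split=> [_ [t _ <-]|_ [t _ <-]]; last by exists t.
exists (t - (Num.floor (t / T))%:~R * T); last first.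
  by have := pz (t - (Num.floor (t / T))%:~R * T) (Num.floor (t / T)); rewrite subrK.
rewrite /= in_itv/= subr_ge0 -ler_pdivlMr// floor_le_tmp /=.
have := floorD1_gt (t / T); rewrite ltr_pdivrMr// intrD mulrDl mul1r; lra.
Qed.

Lemma periodic_orbit_compact : compact Omega.
Proof.
have [p [dp [T T0 [_ -> _ _]]]] := periodic_orbit_param.
by apply: compact_curve => t _; exact: is_derive_continuous (dp t).
Qed.

Lemma periodic_orbit_nonempty : Omega !=set0.
Proof. by have [p [_ [_ _ [_ _ Op _]]]] := periodic_orbit_param; exists (p 0). Qed.

(** An equilibrium on the orbit would hold the solution at all later times, hence by periodicity at
    all times. *)
Lemma vector_field_neq0_orbit q : Omega q -> f q != 0.
Proof.
have [p [dp [T T0 [per OE _ [t pt]]]]] := periodic_orbit_param.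
rewrite OE => -[s _ <-]; apply/eqP => fp0; apply: pt.
have fp : forward_solution f (p s) (fun t => p (s + t)).
  by split=> [|u _]; [rewrite addr0|apply: is_derive_shift_time; exact: dp].
have all_s u : p u = p s.
  have [v sv <-] := per u s.
  have := forward_equilibrium cf fp fp0 (t := v - s); rewrite subr_ge0 => /(_ sv).
  by rewrite addrC subrK.
by rewrite all_s (all_s 0).
Qed.

Lemma dist_orbit_gt0 x : ~ Omega x -> 0 < dist_set x Omega.
Proof.
move=> nOx.
have [|d d0 Hd] := compact_tube (P := fun y => y <> x) periodic_orbit_compact.
  move=> p Op; have px : p != x by apply/eqP => px; apply: nOx; rewrite -px.
  apply/near_normP; exists `|p - x|; first by rewrite normr_gt0 subr_eq0.
  by move=> y + yx; rewrite yx distrC ltxx.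
rewrite ltNge; apply/negP => h.
have /(dist_set_lt_tube periodic_orbit_nonempty)[p Op xp] := le_lt_trans h d0.
exact: (Hd p x Op xp erefl).
Qed.

(** A trajectory starting at an equilibrium stays there, at positive distance from the compact set
    [Omega]. *)
Lemma vector_field_neq0_basin x : basin f Omega x -> f x != 0.
Proof.
move=> [phi fphi dphi]; apply/eqP => fx0.
have nOx : ~ Omega x by move=> /vector_field_neq0_orbit; rewrite fx0 eqxx.
have [t t0 /(_ t (lexx t))] := dist_to0_eventually (dist_orbit_gt0 nOx) dphi.
by rewrite (forward_equilibrium cf fphi fx0 t0) ltxx.
Qed.

Lemma orbit_sub_basin : Omega `<=` basin f Omega.
Proof.
have [p [dp [T T0 [_ OE Op _]]]] := periodic_orbit_param.
rewrite {1}OE => _ [s _ <-]; exists (fun t => p (s + t)).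
  by split=> [|u _]; [rewrite addr0|apply: is_derive_shift_time; exact: dp].
rewrite (_ : (fun t => _) = cst 0); first exact: cvg_cst.
apply/funext => t /=; apply/eqP; rewrite eq_le dist_set_ge0 andbT.
apply: (le_trans (dist_set_le _ (Op (s + t)))).
by apply: (le_trans (enorm_le_norm _)); rewrite subrr normr0 mulr0.
Qed.

(** Compactness is used on the time interval, because [p] may pass through [q] at several times.
    Near such a time [f q != 0] bounds [|s - t|] by a multiple of [|p s - q|], so the tangent error
    is small relative to the latter; near any other time [p] stays away from [q]. *)
Lemma orbit_tangent q (k : R) : Omega q -> 0 < k ->
  exists2 r : R, 0 < r & forall y, Omega y -> `|y - q| < r ->
    exists a : R, `|y - q - a *: f q| <= k * `|y - q|.
Proof.
move=> Oq k0; have fq : 0 < `|f q| by rewrite normr_gt0 vector_field_neq0_orbit.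
have [p [dp [T T0 [_ OE _ _]]]] := periodic_orbit_param.
pose P (r : R) t := `|p t - q| < r -> exists a : R, `|p t - q - a *: f q| <= k * `|p t - q|.
have /compact_near_coveringP cI : compact (`[0, T] : set R) by exact: segment_compact.
have : \forall r \near (0 : R)^'+, `[0, T]%classic `<=` P r.
  apply: cI => t _.
  have [ptq|ptq] := eqVneq (p t) q.
    (* The first bound gives [|s - t| |f q| / 2 <= |p s - q|]; the second then makes the error at
       most [k |p s - q|]. *)
    pose e := Num.min (`|f q| / 2) (k * (`|f q| / 2)).
    have fq2 : 0 < `|f q| / 2 by rewrite divr_gt0.
    have e0 : 0 < e by rewrite lt_min fq2 mulr_gt0.
    have /is_deriveP/(_ e e0)/near_normP[d d0 Hd] := dp t.
    exists ([set s | `|s - t| < d], [set r | 0 < r]).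
      split => /=; last exact: nbhs_right_gt.
      by apply: (iffRL (near_normP (t : R) _)); exists d.
    move=> [s r] /= [st _] _; exists (s - t).
    have := Hd (s - t); rewrite subr0 [t + _]addrC subrK ptq => /(_ st) h.
    apply: (le_trans h).
    have e1 : e <= `|f q| / 2 by rewrite ge_min lexx.
    have e2 : e <= k * (`|f q| / 2) by rewrite ge_min lexx orbT.
    have h2 : `|s - t| * (`|f q| / 2) <= `|p s - q|.
      have : `|(s - t) *: f q| <= `|p s - q| + e * `|s - t|.
        rewrite -[_ *: _](subrK (p s - q)) addrC; apply: (le_trans (ler_normD _ _)).
        by rewrite lerD2l distrC.
      rewrite normrZ; have := ler_wpM2r (normr_ge0 (s - t)) e1; lra.
    apply: (@le_trans _ _ (k * (`|s - t| * (`|f q| / 2)))); last by rewrite ler_wpM2l// ltW.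
    by rewrite mulrCA mulrC ler_wpM2l.
  have D0 : 0 < `|p t - q| / 2 by rewrite divr_gt0// normr_gt0 subr_eq0.
  have /continuous_atP/(_ _ D0)[d d0 Hd] := is_derive_continuous (dp t).
  exists ([set s | `|s - t| < d], [set r | r < `|p t - q| / 2]).
    split => /=; last exact: nbhs_right_lt.
    by apply: (iffRL (near_normP (t : R) _)); exists d.
  move=> [s r] /= [st rD] sr; exfalso.
  have := Hd s st; have : `|p t - q| <= `|p s - p t| + `|p s - q|.
    rewrite -[p t - q](subrK (p s - q)); apply: (le_trans (ler_normD _ _)).
    by rewrite opprB addrA subrK distrC.
  lra.
move=> h.
have : \forall r \near (0 : R)^'+, 0 < r /\ `[0, T]%classic `<=` P r.
  by near=> r; split; near: r; [exact: nbhs_right_gt|exact: h].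
move=> /filter_ex[r [r0 Hr]]; exists r => // y; rewrite OE => -[t t0T <-].
exact: Hr.
Unshelve. all: by end_near.
Qed.

End periodic.

(** * The transverse linear equation *)

Section continuity.
Variables (R : realType) (V : normedModType R).

Lemma continuous_mxP (m n : nat) (M : V -> 'M[R]_(m, n)) (x : V) :
  {for x, continuous M} <-> forall i j, {for x, continuous (fun y => M y i j)}.
Proof.
split=> [/continuous_atP H i j|H]; apply/continuous_atP => e e0.
  have [d d0 Hd] := H e e0; exists d => // y /Hd; apply: le_trans.
  by have := mx_entry_le (M y - M x) i j; rewrite !mxE.
have /= Hij (ij : 'I_m * 'I_n) : \forall y \near x, `|M y ij.1 ij.2 - M x ij.1 ij.2| <= e.
  by apply/near_normP; have /continuous_atP/(_ e e0) := H ij.1 ij.2.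
have /near_normP[d d0 Hd] := @filter_forall _ _ _ _ (nbhs_filter x) Hij.
exists d => // y /Hd h; apply/mx_norm_leP; first exact: ltW.
by move=> i j; rewrite !mxE; exact: (h (i, j)).
Qed.

Lemma continuous_mulmx (m n p : nat) (A : V -> 'M[R]_(m, n)) (B : V -> 'M[R]_(n, p)) (x : V) :
  {for x, continuous A} -> {for x, continuous B} ->
  {for x, continuous (fun y => A y *m B y)}.
Proof.
move=> /continuous_mxP cA /continuous_mxP cB; apply/continuous_mxP => i j.
rewrite (_ : (fun y => _) = fun y => \sum_(k < n) (A y i k * B y k j)); last first.
  by apply/funext => y; rewrite mxE.
apply: cvg_big => [|k _]; first exact: add_continuous.
by apply: cvgM; [exact: cA|exact: cB].
Qed.

Lemma continuous_trmx (m n : nat) (A : V -> 'M[R]_(m, n)) (x : V) :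
  {for x, continuous A} -> {for x, continuous (fun y => (A y)^T)}.
Proof.
move=> /continuous_mxP cA; apply/continuous_mxP => i j.
by rewrite (_ : (fun y => _) = fun y => A y j i)//; apply/funext => y; rewrite mxE.
Qed.

End continuity.

Lemma linear_ode (R : realType) (n : nat) (A : R -> 'M[R]_n) (w0 : 'cV[R]_n) :
  (forall t : R, 0 <= t -> {for t, continuous A}) ->
  exists2 w : R -> 'cV[R]_n, w 0 = w0 & forall t : R, 0 <= t -> is_derive t 1 w (A t *m w t).
Proof.
move=> cA; pose B t := A (Num.max t 0).
have cB : continuous B.
  move=> t; suff : {for t, continuous (A \o (fun t => Num.max t 0))} by [].
  apply: continuous_comp; first exact: max0_continuous.
  by apply: cA; rewrite le_max lexx orbT.
have BE t : 0 <= t -> B t = A t by move=> t0; rewrite /B (max_idPl t0).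
have [||w w0E dw] := @picard R n (fun t u => B t *m u) w0.
- move=> tau tau0; have [C C0 HC] := continuous_bounded_itv tau0 cB.
  exists (n%:R * C); first by rewrite mulr_ge0.
  move=> t a b tt; rewrite -mulmxBr; apply: (le_trans (mulmx_norm_le _ _)).
  by rewrite mulrA ler_wpM2r// ler_wpM2l// HC.
- by move=> u cu t; apply: continuous_mulmx; [exact: cB|exact: cu].
by exists w => // t t0; rewrite -BE//; exact: dw.
Qed.

Section transverse.
Variables (R : realType) (n : nat) (f : 'cV[R]_n -> 'cV[R]_n).
Hypothesis cf : Ck 2 setT f.

Definition transverse_mx (x : 'cV[R]_n) : 'M[R]_n :=
  jacobian_mx f x - (enorm (f x) ^+ 2)^-1 *:
    (f x *m (f x)^T *m (jacobian_mx f x + (jacobian_mx f x)^T)).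

Lemma jacobian_continuous : continuous (jacobian_mx f).
Proof.
move=> x; apply/continuous_mxP => i j.
rewrite (_ : (fun y => _) = fun y => 'D_(basis_vec R j) f y i ord0); last first.
  by apply/funext => y; rewrite jacobian_mxE//; exact: (Ck_has_partials cf).
by move: i ord0; apply/continuous_mxP; exact: (Ck_partials_continuous cf).
Qed.

Lemma jacobian_sym_continuous : continuous (fun x => jacobian_mx f x + (jacobian_mx f x)^T).
Proof.
move=> x; have c1 := @jacobian_continuous x.
exact: (cvgD c1 (continuous_trmx c1)).
Qed.

Lemma enorm_inv_continuous x : f x != 0 ->
  {for x, continuous (fun x => (enorm (f x) ^+ 2)^-1)}.
Proof.
move=> fx; have fx2 : enorm (f x) ^+ 2 != 0 by rewrite sqrf_eq0 gt_eqF// enorm_gt0.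
suff cs : {for x, continuous (fun x => enorm (f x) ^+ 2)} by exact: (cvgV fx2 cs).
rewrite (_ : (fun x => _) = fun x => ((f x)^T *m f x) ord0 ord0); last first.
  by apply/funext => y; rewrite enorm_sqrE.
have cfx := vector_field_continuous cf (x := x).
by have /continuous_mxP := continuous_mulmx (continuous_trmx cfx) cfx; exact.
Qed.

Lemma transverse_mx_continuous x : f x != 0 -> {for x, continuous transverse_mx}.
Proof.
move=> fx; have cfx := vector_field_continuous cf (x := x).
have c1 := @jacobian_continuous x.
have c2 := continuous_mulmx (continuous_mulmx cfx (continuous_trmx cfx))
  (@jacobian_sym_continuous x).
exact: (cvgB c1 (cvgZ (enorm_inv_continuous fx) c2)).
Qed.

Lemma dot_self (v : 'cV[R]_n) : v^T *m v = (enorm v ^+ 2)%:M.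
Proof. by rewrite enorm_sqrE -mx11_scalar. Qed.

Section solution.
Variables (phi : R -> 'cV[R]_n).
Hypothesis dphi : forall t : R, 0 <= t -> is_derive t 1 phi (f (phi t)).
Hypothesis fphi : forall t : R, 0 <= t -> f (phi t) != 0.

Definition transverse_solution (w : R -> 'cV[R]_n) :=
  forall t : R, 0 <= t -> is_derive t 1 w (transverse_mx (phi t) *m w t).

Lemma transverse_solution_exists w0 : exists2 w, w 0 = w0 & transverse_solution w.
Proof.
apply: (@linear_ode R n (fun t => transverse_mx (phi t))) => t t0.
suff : {for t, continuous (transverse_mx \o phi)} by [].
apply: continuous_comp; first exact: is_derive_continuous (dphi t0).
exact: transverse_mx_continuous (fphi t0).
Qed.

(** Hence [f^T w' = - (J f)^T w], which cancels the contribution of the derivative of [f] to that of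
    [f^T w]. *)
Lemma dot_transverse_mx t : 0 <= t ->
  (f (phi t))^T *m transverse_mx (phi t) = - ((f (phi t))^T *m (jacobian_mx f (phi t))^T).
Proof.
move=> t0; rewrite /transverse_mx mulmxBr -scalemxAr !mulmxA dot_self mul_scalar_mx.
rewrite -scalemxAl scalerA mulVf; last by rewrite expf_neq0// gt_eqF// enorm_gt0// fphi.
by rewrite scale1r mulmxDr opprD addrA subrr sub0r.
Qed.

Lemma transverse_dot_constant w : transverse_solution w ->
  forall t : R, 0 <= t -> (f (phi t))^T *m w t = (f (phi 0))^T *m w 0.
Proof.
move=> dw t t0.
apply: (@derive0_constant _ _ _ (fun t => (f (phi t))^T *m w t) 0 t t0) => s /andP[s0 _].
have d1 := is_derive_trmx (is_derive_vector_field cf (dphi s0)).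
have := is_derive_mulmx d1 (dw s s0).
by rewrite /= mulmxA dot_transverse_mx// trmx_mul mulNmx subrr.
Qed.

(** The two equations differ by a multiple of [f], and [f] itself solves the variational equation;
    adding [c f] with [c' = g] absorbs the difference. Values in ['cV[R]_1] let [c] multiply [f] as
    a matrix. *)
Lemma transverse_variational w : transverse_solution w ->
  exists2 c : R -> 'cV[R]_1, c 0 = 0 & forall t : R, 0 <= t ->
    is_derive t 1 (fun t => w t + f (phi t) *m c t)
      (jacobian_mx f (phi t) *m (w t + f (phi t) *m c t)).
Proof.
move=> dw.
pose g x v : 'cV[R]_1 := (enorm (f x) ^+ 2)^-1 *:
  ((f x)^T *m (jacobian_mx f x + (jacobian_mx f x)^T) *m v).
have cg : continuous (fun t : R => g (phi (Num.max t 0)) (w (Num.max t 0))).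
  move=> t; suff : {for t, continuous
    ((fun t => g (phi t) (w t)) \o (fun t : R => Num.max t 0))} by [].
  apply: continuous_comp; first exact: max0_continuous.
  have : 0 <= Num.max t 0 by rewrite le_max lexx orbT.
  move: (Num.max t 0) => s s0.
  have cp := is_derive_continuous (dphi s0); have cw := is_derive_continuous (dw s s0).
  have c1 : {for s, continuous ((fun x => (enorm (f x) ^+ 2)^-1) \o phi)}.
    by apply: continuous_comp => //; exact: enorm_inv_continuous (fphi s0).
  have c2 : {for s, continuous (f \o phi)}.
    by apply: continuous_comp => //; exact: vector_field_continuous.
  have c3 : {for s, continuous ((fun x => jacobian_mx f x + (jacobian_mx f x)^T) \o phi)}.
    by apply: continuous_comp => //; exact: jacobian_sym_continuous.
  exact: (cvgZ c1 (continuous_mulmx (continuous_mulmx (continuous_trmx c2) c3) cw)).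
have [c c0 dc] := antiderivative cg.
exists c => // t t0.
have := dc t t0; rewrite (max_idPl t0) => dct.
have d1 := is_derive_mulmx (is_derive_vector_field cf (dphi t0)) dct.
have := is_deriveD (dw t t0) d1; congr is_derive.
rewrite /transverse_mx /g /= mulmxBl [RHS]mulmxDr -scalemxAr -scalemxAl !mulmxA.
by rewrite addrACA addNr addr0.
Qed.

End solution.
End transverse.

(** * Contraction transverse to the orbit *)

Section contraction.
Variables (R : realType) (n : nat) (f : 'cV[R]_n -> 'cV[R]_n).
Hypothesis cf : Ck 2 setT f.
Variables (Omega : set 'cV[R]_n).
Hypothesis perO : periodic_orbit f Omega.

Lemma periodic_orbit_solution q : Omega q -> exists p : R -> 'cV[R]_n,
  [/\ p 0 = q, forall t : R, is_derive t 1 p (f (p t)) & forall t, Omega (p t)].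
Proof.
have [p [dp [T T0 [_ OE Op _]]]] := periodic_orbit_param perO.
rewrite {1}OE => -[s _ <-]; exists (fun t => p (s + t)); split => //.
  by rewrite addr0.
by move=> t; apply: is_derive_shift_time; exact: dp.
Qed.

Lemma expR_decay (A mu k : R) : 0 < mu -> 0 < k ->
  exists2 T : R, 0 < T & A * expR (- (mu * T)) < k.
Proof.
move=> mu0 k0; exists (`|A| / (k * mu) + 1).
  by rewrite ltr_wpDl// divr_ge0// mulr_ge0// ltW.
set T := _ + 1; have T0 : 0 <= T by rewrite /T addr_ge0// divr_ge0// mulr_ge0// ltW.
rewrite expRN ltr_pdivrMr ?expR_gt0//.
apply: (le_lt_trans (ler_norm A)).
apply: (@lt_le_trans _ _ (k * (1 + mu * T))); last by rewrite ler_wpM2l ?expR_ge1Dx// ltW.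
have -> : k * (1 + mu * T) = `|A| + k * (1 + mu).
  by rewrite /T; field; rewrite !gt_eqF.
by rewrite ltrDl mulr_gt0// addr_gt0.
Qed.

(** * Comparison of nearby solutions with the orbit over a fixed time *)

Section estimate.
Variables (d L : R).
Hypothesis L0 : 0 < L.
Hypothesis HL : forall p p' a, Omega p -> Omega p' -> `|a - p'| < d ->
  [/\ `|f a - f p| <= L * `|a - p|,
      `|jacobian_mx f a - jacobian_mx f p| <= L * `|a - p|,
      `|jacobian_mx f a| <= L
    & `|f a - f p - jacobian_mx f p *m (a - p)| <= L * `|a - p| ^+ 2].
Variables (T C : R).
Hypothesis C0 : 0 < C.
Hypothesis HC : forall (u u' : R -> 'cV[R]_n) (b : R), 0 <= b ->
      (forall t, 0 <= t <= T -> is_derive t 1 u (u' t)) ->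
      (forall t, 0 <= t <= T -> `|u' t| <= (n%:R + 1) * L * `|u t| + b) ->
      forall t, 0 <= t <= T -> `|u t| <= C * (`|u 0| + b).
Variables (p : R -> 'cV[R]_n).
Hypothesis dp : forall t : R, is_derive t 1 p (f (p t)).
Hypothesis Op : forall t, Omega (p t).

Let tube (y : R -> 'cV[R]_n) := forall t, 0 <= t -> exists2 q, Omega q & `|y t - q| < d.

(** Being in the tube says nothing about the phase, but [HL] still compares [phi t] with [p t] at
    the same time. The rate [(n + 1) L] in [HC] covers this Lipschitz bound as well as the products
    with Jacobians in the next lemmas. *)
Lemma tube_solution_close x (phi : R -> 'cV[R]_n) : forward_solution f x phi -> tube phi ->
  forall t, 0 <= t <= T -> `|phi t - p t| <= C * `|x - p 0|.
Proof.
move=> [phi0 dphi] tphi t tT.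
have := @HC (phi - p) (fun t => f (phi t) - f (p t)) 0 (lexx 0) _ _ t tT.
rewrite !fctE phi0 addr0; apply=> s sT; have /andP[s0 _] := sT.
  by apply: is_deriveB; exact: dphi.
rewrite addr0; have [q Oq qd] := tphi s s0.
have [H _ _ _] := HL (Op s) Oq qd; apply: (le_trans H).
rewrite ler_wpM2r// ler_peMl ?(ltW L0)//.
by rewrite lerDr.
Qed.

Lemma variational_bounded (phi v : R -> 'cV[R]_n) : tube phi ->
  (forall t : R, 0 <= t -> is_derive t 1 v (jacobian_mx f (phi t) *m v t)) ->
  forall t, 0 <= t <= T -> `|v t| <= C * `|v 0|.
Proof.
move=> tphi dv t tT.
have := @HC v (fun t => jacobian_mx f (phi t) *m v t) 0 (lexx 0) _ _ t tT.
rewrite addr0; apply=> s sT; have /andP[s0 _] := sT; first exact: dv.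
rewrite addr0; have [q Oq qd] := tphi s s0.
have [_ _ H _] := HL Oq Oq qd; apply: (le_trans (mulmx_norm_le _ _)).
rewrite mulrA ler_wpM2r// ler_pM//.
by rewrite lerDl.
Qed.

(** [v] is linearised along [phi], while the quotient is taken at the orbit [p]. Since [phi] and [y]
    stay within [C eps] of [p], the mismatch of Jacobians and the Taylor remainder divided by [eps]
    are both of order [eps], and Gronwall starts from zero. *)
Lemma difference_quotient_close x y0 (phi y v : R -> 'cV[R]_n) (eps : R) : 0 < eps ->
  forward_solution f x phi -> tube phi -> forward_solution f y0 y -> tube y ->
  (forall t : R, 0 <= t -> is_derive t 1 v (jacobian_mx f (phi t) *m v t)) ->
  `|v 0| <= 1 -> y0 = p 0 + eps *: v 0 -> `|x - p 0| <= eps ->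
  forall t, 0 <= t <= T -> `|v t - eps^-1 *: (y t - p t)|
     <= C * ((n%:R + 1) * L * C ^+ 2 * eps).
Proof.
move=> eps0 sphi tphi sy ty dv v01 y0E xp t tT.
have n0 := ler0n R n.
have vle s : 0 <= s <= T -> `|v s| <= C.
  move=> sT; apply: (le_trans (variational_bounded tphi dv sT)).
  by rewrite ler_piMr// ltW.
have phile s : 0 <= s <= T -> `|phi s - p s| <= C * eps.
  move=> sT; apply: (le_trans (tube_solution_close sphi tphi sT)).
  by rewrite ler_wpM2l// ltW.
have yle s : 0 <= s <= T -> `|y s - p s| <= C * eps.
  move=> sT; apply: (le_trans (tube_solution_close sy ty sT)).
  rewrite ler_wpM2l// ?(ltW C0)// y0E addrC addKr normrZ gtr0_norm//.
  by rewrite ler_piMr// ltW.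
(* [n L C^2 eps] from the Jacobian mismatch plus [L C^2 eps] from the Taylor remainder. *)
set b := (n%:R + 1) * L * C ^+ 2 * eps.
have b0 : 0 <= b by rewrite !mulr_ge0 ?addr_ge0 ?exprn_ge0// ltW.
have := @HC (fun s => v s - eps^-1 *: (y s - p s))
  (fun s => jacobian_mx f (phi s) *m v s - eps^-1 *: (f (y s) - f (p s))) b b0 _ _ t tT.
have [y00 dy] := sy.
rewrite y00 y0E [p 0 + _]addrC addrK scalerA mulVf ?gt_eqF// scale1r subrr normr0 add0r.
apply=> s sT; have /andP[s0 _] := sT.
  apply: is_deriveB; first exact: dv.
  apply: is_deriveZ; apply: is_deriveB; exact: dy.
have [q Oq qd] := tphi s s0; have [q' Oq' qd'] := ty s s0.
have [_ H2 _ _] := HL (Op s) Oq qd.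
have [_ _ _ H4] := HL (Op s) Oq' qd'.
have pd : `|p s - p s| < d by rewrite subrr normr0 (le_lt_trans _ qd).
have [_ _ H3 _] := HL (Op s) (Op s) pd.
have -> : jacobian_mx f (phi s) *m v s - eps^-1 *: (f (y s) - f (p s)) =
   jacobian_mx f (p s) *m (v s - eps^-1 *: (y s - p s)) +
   ((jacobian_mx f (phi s) - jacobian_mx f (p s)) *m v s -
    eps^-1 *: (f (y s) - f (p s) - jacobian_mx f (p s) *m (y s - p s))).
  have E (A B D G : 'cV[R]_n) : A - G = B - D + (A - B - (G - D)).
    by apply/matrixP => i j; rewrite !mxE; ring.
  by rewrite mulmxBr mulmxBl -scalemxAr [eps^-1 *: (_ - _ *m _)]scalerBr; exact: E.
apply: (le_trans (ler_normD _ _)); apply: lerD.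
  apply: (le_trans (mulmx_norm_le _ _)).
  rewrite mulrA ler_wpM2r// ler_pM//.
  by rewrite lerDl.
apply: (le_trans (ler_normB _ _)).
rewrite /b mulrDl mul1r 2!mulrDl; apply: lerD.
  apply: (le_trans (mulmx_norm_le _ _)).
  rewrite -!mulrA ler_wpM2l//.
  apply: (@le_trans _ _ (L * (C * eps) * C)).
    rewrite ler_pM// ?vle//; apply: (le_trans H2).
    by rewrite ler_wpM2l ?(ltW L0)// phile.
  by rewrite le_eqVlt; apply/orP; left; apply/eqP; ring.
rewrite normrZ gtr0_norm ?invr_gt0// mulrC ler_pdivrMr//.
apply: (le_trans H4).
have h : `|y s - p s| ^+ 2 <= (C * eps) ^+ 2.
  by rewrite ler_sqr ?nnegrE ?yle// mulr_ge0// ltW.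
apply: (le_trans (ler_wpM2l (ltW L0) h)).
by rewrite le_eqVlt; apply/orP; left; apply/eqP; ring.
Qed.

End estimate.
End contraction.

Lemma transverse_solutionZ (R : realType) (n : nat) (f : 'cV[R]_n -> 'cV[R]_n)
    (phi w : R -> 'cV[R]_n) (a : R) :
  transverse_solution f phi w -> transverse_solution f phi (fun t => a *: w t).
Proof.
by move=> dw t t0; rewrite -scalemxAr; apply: is_deriveZ; exact: dw.
Qed.

Section contraction.
Variables (R : realType) (n : nat) (f : 'cV[R]_n -> 'cV[R]_n).
Hypothesis cf : Ck 2 setT f.
Variables (Omega : set 'cV[R]_n).
Hypothesis perO : periodic_orbit f Omega.
Hypothesis stableO : exponentially_stable f Omega.

(** The radius [d] and the time [T] are common to the whole orbit; only [eta] depends on [p0], and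
    compactness removes this dependence in [transverse_decay]. *)
Lemma transverse_contraction : exists2 d : R, 0 < d & exists2 T : R, 0 < T &
  forall p0, Omega p0 -> exists2 eta : R, 0 < eta &
    forall x phi w, forward_solution f x phi -> `|x - p0| < eta ->
      (forall t, 0 <= t -> dist_set (phi t) Omega < d) ->
      (forall t, 0 <= t -> f (phi t) != 0) ->
      transverse_solution f phi w -> (f x)^T *m w 0 = 0 ->
      `|w T| <= `|w 0| / 2.
Proof.
have cO := periodic_orbit_compact perO.
have O0 := periodic_orbit_nonempty perO.
have [d d0 [L L0 HL]] := C2_tube_global cf cO.
have [delta [K [mu [delta0 K0 mu0 st]]]] := stableO.
have n0 := ler0n R n.
have n1 : 0 < n%:R + 1 :> R by rewrite ltr_wpDl.
(* The vector estimated at time [T] has sup norm at most [3 k0], hence Euclidean norm at most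
   [3 n k0 <= 3 / 8 < 1 / 2]. *)
pose k0 := (8 * (n%:R + 1))^-1 : R.
have k00 : 0 < k0 by rewrite invr_gt0 mulr_gt0.
(* In time [T] stability reduces a Euclidean distance [n eps] from [Omega] to less than [k0 eps]. *)
have [T T0 HT] := expR_decay (K * n%:R) mu0 k00.
exists d => //; exists T => // p0 Op0.
have nL : 0 <= (n%:R + 1) * L by rewrite mulr_ge0// ltW.
have [C C0 HC] := @gronwall R n T ((n%:R + 1) * L) (ltW T0) nL.
have [p [p00 dp Op]] := periodic_orbit_solution perO Op0.
have fp1 : 0 < `|f (p T)| by rewrite normr_gt0 (vector_field_neq0_orbit cf perO).
have k0C : 0 < k0 + C by rewrite addr_gt0.
(* With this tolerance the tangent error over a distance [(k0 + C) eps] is at most [k0 eps], and at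
   most that distance itself. *)
pose k := Num.min 1 (k0 / (k0 + C)).
have k_gt0 : 0 < k by rewrite lt_min ltr01 divr_gt0.
have [r r0 Hr] := orbit_tangent cf perO (Op T) k_gt0.
pose C1 := C * ((n%:R + 1) * L * C ^+ 2).
have C10 : 0 <= C1 by rewrite mulr_ge0 ?(ltW C0)// mulr_ge0// exprn_ge0// ltW.
pose a1 := 2 * (k0 + C) / `|f (p T)|.
have a10 : 0 <= a1 by rewrite divr_ge0// mulr_ge0// ltW.
pose C2 := C1 + a1 * (L * C).
have C20 : 0 <= C2 by rewrite addr_ge0// mulr_ge0// mulr_ge0// ltW.
(* In order: [y0] lies in the stability neighbourhood; its trajectory stays in the [d]-tube; the
   orbit point near [y T] is within reach of the tangent estimate at [p T]; the errors of second
   order in [eps] are at most [k0 eps]. *)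
pose eps := Num.min (Num.min (delta / (n%:R + 1)) (d / (K * (n%:R + 1))))
                    (Num.min (r / (k0 + C) / 2) (k0 / (C2 + 1))).
have Kn : 0 < K * (n%:R + 1) by rewrite mulr_gt0.
have C21 : 0 < C2 + 1 by rewrite ltr_wpDl.
have eps0 : 0 < eps by rewrite !lt_min !divr_gt0.
have eps_delta : eps * (n%:R + 1) <= delta.
  by rewrite -ler_pdivlMr// !ge_min lexx.
have eps_d : eps * (K * (n%:R + 1)) <= d.
  by rewrite -ler_pdivlMr// !ge_min lexx ?orbT.
have eps_r : eps * (k0 + C) < r.
  rewrite -ltr_pdivlMr//; apply: (@le_lt_trans _ _ (r / (k0 + C) / 2)).
    by rewrite !ge_min lexx ?orbT.
  by rewrite ltr_pdivrMr// ltr_pMr ?divr_gt0// ltr1n.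
have eps_C2 : C2 * eps <= k0.
  apply: (@le_trans _ _ (eps * (C2 + 1))).
    by rewrite mulrC ler_wpM2l ?(ltW eps0)// lerDl.
  by rewrite -ler_pdivlMr// !ge_min lexx ?orbT.
exists eps => // x phi.
(* By linearity it is enough to treat [|w 0| <= 1]; if [w 0 = 0], scaling by [1 / |w T|] would
   contradict the bound unless [w T = 0]. *)
suff core w : forward_solution f x phi -> `|x - p0| < eps ->
      (forall t, 0 <= t -> dist_set (phi t) Omega < d) ->
      (forall t, 0 <= t -> f (phi t) != 0) ->
      transverse_solution f phi w -> (f x)^T *m w 0 = 0 -> `|w 0| <= 1 ->
      `|w T| <= 2^-1.
  move=> w sphi xp tphi fphi dw fw.
  have scaled a : `|a *: w 0| <= 1 -> `|a *: w T| <= 2^-1.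
    apply: (core (fun t => a *: w t)) => //; first exact: transverse_solutionZ.
    by rewrite -scalemxAr fw scaler0.
  have [w00|w00] := eqVneq (w 0) 0.
    rewrite w00 normr0 mul0r normr_le0; apply/eqP; apply: contrapT => /eqP wT.
    have := scaled (`|w T|^-1); rewrite w00 scaler0 normr0 ler01 normrZ normfV normr_id.
    by rewrite mulVf ?normr_eq0// => /(_ isT); rewrite leNgt invf_lt1// ltr1n.
  have w0p : 0 < `|w 0| by rewrite normr_gt0.
  have := scaled (`|w 0|^-1); rewrite !normrZ normfV normr_id mulVf ?gt_eqF//.
  by move=> /(_ (lexx _)); rewrite mulrC ler_pdivrMr// mulrC.
move=> sphi xp dist_phi fphi dw fw w01.
have [phi0 dphi] := sphi.
have tphi t : 0 <= t -> exists2 q, Omega q & `|phi t - q| < d.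
  by move=> /dist_phi; exact: dist_set_lt_tube.
have [c c0 dv] := transverse_variational cf dphi fphi dw.
set v := (fun t => w t + f (phi t) *m c t) in dv.
have v0 : v 0 = w 0 by rewrite /v c0 mulmx0 addr0.
have v01 : `|v 0| <= 1 by rewrite v0.
(* The displacement is made from the orbit rather than from [x]: at time [T] the base point [p T] is
   then on [Omega], where the tangent estimate is available. *)
pose y0 := p 0 + eps *: v 0.
have dy0 : dist_set y0 Omega <= eps * n%:R.
  apply: (le_trans (dist_set_le _ (Op 0))); rewrite /y0 addrC addKr.
  apply: (le_trans (enorm_le_norm _)); rewrite normrZ gtr0_norm// mulrC.
  by rewrite ler_wpM2r// ler_piMr// ltW.
have [|y sy dy] := st y0.
  apply: (le_lt_trans dy0); apply: lt_le_trans eps_delta.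
  by rewrite ltr_pM2l// ltrDl.
have ty t : 0 <= t -> exists2 q, Omega q & `|y t - q| < d.
  move=> t0; apply: dist_set_lt_tube => //; apply: (le_lt_trans (dy t t0)).
  apply: lt_le_trans eps_d; apply: (@le_lt_trans _ _ (K * (eps * n%:R))).
    rewrite ler_pM ?dist_set_ge0//; first by rewrite mulr_ge0 ?expR_ge0// ltW.
    by rewrite ler_piMr ?(ltW K0)// -expR0 ler_expR oppr_le0 mulr_ge0// ltW.
  by rewrite mulrCA ltr_pM2l// ltr_pM2l// ltrDl.
have TT : 0 <= T <= T by rewrite lexx ltW.
have xp0 : `|x - p 0| <= eps by rewrite p00 ltW.
have zT := difference_quotient_close L0 HL C0 HC dp Op eps0 sphi tphi sy ty dv v01 erefl xp0 TT.
have yT := tube_solution_close L0 HL HC dp Op sy ty TT.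
have phiT := tube_solution_close L0 HL HC dp Op sphi tphi TT.
have {}yT : `|y T - p T| <= C * eps.
  apply: (le_trans yT); rewrite ler_wpM2l ?(ltW C0)// /y0 addrC addKr normrZ gtr0_norm//.
  by rewrite ler_piMr// ltW.
have {}phiT : `|phi T - p T| <= C * eps.
  by apply: (le_trans phiT); rewrite ler_wpM2l// ltW.
have dyT : dist_set (y T) Omega < k0 * eps.
  apply: (le_lt_trans (dy T (ltW T0))).
  apply: (@le_lt_trans _ _ (K * expR (- (mu * T)) * (eps * n%:R))).
    by rewrite ler_wpM2l// mulr_ge0 ?expR_ge0// ltW.
  rewrite (_ : _ * (_ * _) = K * n%:R * expR (- (mu * T)) * eps); last by ring.
  by rewrite ltr_pM2r.
have [q Oq yq] := dist_set_lt_tube O0 dyT.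
have qp : `|q - p T| <= (k0 + C) * eps.
  rewrite -(subrK (y T) q) -addrA; apply: (le_trans (ler_normD _ _)).
  by rewrite mulrDl lerD// distrC ltW.
have [|a Ha] := Hr q Oq; first by apply: (le_lt_trans qp); rewrite mulrC.
have {}Ha : `|q - p T - a *: f (p T)| <= k * ((k0 + C) * eps).
  by apply: (le_trans Ha); rewrite ler_wpM2l// ltW.
have kle1 : k <= 1 by rewrite ge_min lexx.
have kle2 : k * (k0 + C) <= k0 by rewrite -ler_pdivlMr// ge_min lexx orbT.
have aE : `|a| <= a1 * eps.
  have : `|a *: f (p T)| <= 2 * ((k0 + C) * eps).
    rewrite -(subrK (q - p T) (a *: _)); apply: (le_trans (ler_normD _ _)).
    rewrite distrC.
    have : k * ((k0 + C) * eps) <= (k0 + C) * eps by rewrite ler_piMl// mulr_ge0// ltW.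
    lra.
  rewrite normrZ -ler_pdivlMr// => h; apply: (le_trans h).
  by rewrite /a1 le_eqVlt; apply/orP; left; apply/eqP; ring.
have fT : `|f (p T) - f (phi T)| <= L * (C * eps).
  have [q' Oq' qd'] := tphi T (ltW T0).
  have [H _ _ _] := HL _ _ _ (Op T) Oq' qd'; rewrite distrC; apply: (le_trans H).
  by rewrite ler_wpM2l// ltW.
(* Going from [y T] to [q] costs [k0 eps], from [q] to the tangent line at [p T] another [k0 eps].
   Replacing [f (p T)] by [f (phi T)] and the error of the difference quotient together cost
   [C2 eps^2 <= k0 eps]. All is divided by [eps]. *)
have main : `|v T - (a / eps) *: f (phi T)| <= 3 * k0.
  have E (V F P Q Y Z : 'cV[R]_n) : V - (a / eps) *: F = (V - eps^-1 *: (Y - P)) +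
     eps^-1 *: ((Y - Q) + (Q - P - a *: Z) + a *: (Z - F)).
    apply/matrixP => i j; rewrite !mxE; field; exact: lt0r_neq0.
  rewrite (E (v T) (f (phi T)) (p T) q (y T) (f (p T))).
  apply: (le_trans (ler_normD _ _)).
  rewrite normrZ gtr0_norm ?invr_gt0//.
  have h1 : `|(y T - q) + (q - p T - a *: f (p T)) + a *: (f (p T) - f (phi T))| <=
     k0 * eps + k * ((k0 + C) * eps) + (a1 * eps) * (L * (C * eps)).
    apply: (le_trans (ler_normD _ _)); apply: lerD; last by rewrite normrZ ler_pM.
    by apply: (le_trans (ler_normD _ _)); apply: lerD => //; exact: ltW.
  have h2 : eps^-1 * `|(y T - q) + (q - p T - a *: f (p T)) + a *: (f (p T) - f (phi T))| <=
     k0 + k * (k0 + C) + a1 * (L * C) * eps.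
    rewrite mulrC ler_pdivrMr//; apply: (le_trans h1).
    by rewrite le_eqVlt; apply/orP; left; apply/eqP; ring.
  apply: (le_trans (lerD zT h2)).
  have -> : C * ((n%:R + 1) * L * C ^+ 2 * eps) + (k0 + k * (k0 + C) + a1 * (L * C) * eps) =
     k0 + k * (k0 + C) + C2 * eps by rewrite /C2 /C1; ring.
  move: kle2 eps_C2; move: (k * _) (C2 * _) => A B; lra.
have fwT : ((f (phi T))^T *m w T) ord0 ord0 = 0.
  by rewrite (transverse_dot_constant cf dphi fphi dw (ltW T0)) phi0 fw mxE.
apply: (le_trans (norm_le_enorm _)).
(* This multiple of [f (phi T)] turns [w T] into the vector just estimated; [w T] is orthogonal to
   [f (phi T)], hence no longer than that vector. *)
pose g := c T ord0 ord0 - a / eps.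
apply: (le_trans (enorm_orthogonal_le g fwT)).
have -> : w T + g *: f (phi T) = v T - (a / eps) *: f (phi T).
  rewrite /v /g scalerBl addrA; congr (_ + _ - _).
  by rewrite [c T in RHS]mx11_scalar mul_mx_scalar.
apply: (le_trans (enorm_le_norm _)).
apply: (@le_trans _ _ (n%:R * (3 * k0))); first by rewrite ler_wpM2l.
apply: (@le_trans _ _ ((n%:R + 1) * (3 * k0))).
  by rewrite ler_wpM2r ?lerDl// mulr_ge0// ltW.
have -> : (n%:R + 1) * (3 * k0) = 3 / 8 by rewrite /k0; field; rewrite gt_eqF.
by lra.
Qed.

End contraction.

(** * Uniqueness *)

Lemma norm_trmx_le (R : realType) (m n : nat) (A : 'M[R]_(m, n)) : `|A^T| <= `|A|.
Proof. by apply/mx_norm_leP => // i j; rewrite mxE mx_entry_le. Qed.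

Lemma bilinear_norm_le (R : realType) (n : nat) (v w : 'cV[R]_n) (N : 'M[R]_n) :
  `|v^T *m N *m w| <= n%:R ^+ 2 * (`|v| * `|N| * `|w|).
Proof.
apply: (le_trans (mulmx_norm_le _ _)); rewrite expr2 -!mulrA ler_wpM2l//.
rewrite !mulrA ler_wpM2r//; apply: (le_trans (mulmx_norm_le _ _)).
by rewrite mulrA ler_wpM2r// ler_wpM2l// norm_trmx_le.
Qed.

Section linear_operator.
Variables (R : realType) (n : nat) (f : 'cV[R]_n -> 'cV[R]_n).

Lemma trmx_transverse x : (transverse_mx f x)^T = (jacobian_mx f x)^T -
  (enorm (f x) ^+ 2)^-1 *:
    ((jacobian_mx f x + (jacobian_mx f x)^T) *m (f x *m (f x)^T)).
Proof.
have E (A B : 'M[R]_n) : (A - B)^T = A^T - B^T by apply/matrixP => i j; rewrite !mxE.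
have EZ (a : R) (B : 'M[R]_n) : (a *: B)^T = a *: B^T by apply/matrixP => i j; rewrite !mxE.
have ED (A B : 'M[R]_n) : (A + B)^T = A^T + B^T by apply/matrixP => i j; rewrite !mxE.
rewrite /transverse_mx E EZ; congr (_ - _ *: _).
rewrite trmx_mul ED trmxK [X in X *m _]addrC; congr (_ *m _).
by rewrite trmx_mul trmxK.
Qed.

Lemma LopE M x : Lop f M x = orbital_derivative f M x +
  (transverse_mx f x)^T *m M x + M x *m transverse_mx f x.
Proof.
rewrite /Lop trmx_transverse /transverse_mx.
set S := _ + _^T; set s := _^-1; set D := jacobian_mx f x; set m := M x.
rewrite mulmxBl mulmxBr -scalemxAl -scalemxAr !mulmxA.
have E (a b c d e : 'M[R]_n) : a + b + c - d - e = a + (b - e) + (c - d).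
  by apply/matrixP => i j; rewrite !mxE; ring.
exact: E.
Qed.

Lemma dirder_orbital M x : has_partials M x ->
  dirder M x (f x) = orbital_derivative f M x.
Proof.
move=> pM; apply/matrixP => i j; rewrite /dirder summxE !mxE.
apply: eq_bigr => k _; rewrite !mxE derive_mx; last exact: pM.
by rewrite mxE mulrC.
Qed.

End linear_operator.

Section flow_direction.
Variables (R : realType) (n : nat) (f : 'cV[R]_n -> 'cV[R]_n).
Hypothesis cf : Ck 2 setT f.

(** Normalised by [f^T h = 1], so that subtracting a multiple of it makes any vector orthogonal to
    [f]. *)
Definition flow_covector (x : 'cV[R]_n) : 'cV[R]_n := (enorm (f x) ^+ 2)^-1 *: f x.

Lemma flow_covector_continuous x : f x != 0 -> {for x, continuous flow_covector}.
Proof.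
move=> fx; exact: (cvgZ (enorm_inv_continuous cf fx) (vector_field_continuous cf (x := x))).
Qed.

Lemma dot_flow_covector x : f x != 0 -> (f x)^T *m flow_covector x = 1%:M.
Proof.
move=> fx; rewrite -scalemxAr dot_self scale_scalar_mx mulVf//.
by rewrite expf_neq0// gt_eqF// enorm_gt0.
Qed.

(** In the derivative of [f / |f|^2] the numerator contributes [J f] and the denominator
    [f^T (J + J^T) f]; these assemble to the transverse matrix applied to the same vector. *)
Lemma flow_covector_transverse phi :
  (forall t : R, 0 <= t -> is_derive t 1 phi (f (phi t))) ->
  (forall t, 0 <= t -> f (phi t) != 0) ->
  transverse_solution f phi (flow_covector \o phi).
Proof.
move=> dphi fphi t t0.
have df := is_derive_vector_field cf (dphi t t0).
have fx2 : enorm (f (phi t)) ^+ 2 != 0 by rewrite expf_neq0// gt_eqF// enorm_gt0// fphi.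
set J := jacobian_mx f (phi t) in df.
pose q t := ((f (phi t))^T *m f (phi t)) ord0 ord0.
have qE s : q s = enorm (f (phi s)) ^+ 2 by rewrite enorm_sqrE.
pose q' := ((f (phi t))^T *m (J + J^T) *m f (phi t)) ord0 ord0.
have dq : is_derive t 1 q q'.
  have /is_derive_mxP/(_ ord0 ord0) := is_derive_mulmx (is_derive_trmx df) df.
  rewrite /q' mulmxDr mulmxDl trmx_mul /= !mulmxA.
  by rewrite [_ *m J^T *m _ + _]addrC.
have qt : q t != 0 by rewrite qE.
have [dq1 dq2] := dq.
have dqi : is_derive t 1 (fun s => (q s)^-1) (- (q t) ^- 2 *: q').
  by split; [exact: derivableV|rewrite deriveV// dq2].
have dc : is_derive t 1 (fun s => (q s)^-1%:M : 'M[R]_1) ((- (q t) ^- 2 *: q')%:M).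
  apply/is_derive_mxP => i j; rewrite !ord1 mxE eqxx mulr1n.
  by rewrite (_ : (fun _ => _) = fun s => (q s)^-1)//; apply/funext => s; rewrite mxE eqxx mulr1n.
have := is_derive_mulmx df dc.
rewrite (_ : (fun y : R => _) = flow_covector \o phi); last first.
  by apply/funext => s; rewrite /= mul_mx_scalar qE.
congr is_derive.
rewrite /flow_covector /transverse_mx -/J /= mul_mx_scalar -scalemxAr mul_mx_scalar.
rewrite mulmxBl scalerBr; congr (_ + _); first by rewrite qE.
rewrite -scalemxAl scalerA -!mulmxA [X in f (phi t) *m X]mulmxA.
rewrite [(f (phi t))^T *m _ *m _]mx11_scalar -/q' mul_mx_scalar scalerA -scaleNr qE.
by congr (_ *: _); rewrite /GRing.scale/= mulNr expr2 invfM.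
Qed.

End flow_direction.

Section uniqueness.
Variables (R : realType) (n : nat) (f : 'cV[R]_n -> 'cV[R]_n).
Variables (Omega : set 'cV[R]_n) (C M1 M2 : 'cV[R]_n -> 'M[R]_n).
Hypothesis cf : Ck 2 setT f.
Hypothesis perO : periodic_orbit f Omega.
Hypothesis stableO : exponentially_stable f Omega.
Hypothesis cM1 : Ck 1 (basin f Omega) M1.
Hypothesis cM2 : Ck 1 (basin f Omega) M2.
Hypothesis LM1 : forall x, basin f Omega x -> Lop f M1 x = - C x.
Hypothesis LM2 : forall x, basin f Omega x -> Lop f M2 x = - C x.

Let N x := M1 x - M2 x.

Lemma is_derive_orbital (M : 'cV[R]_n -> 'M[R]_n) (phi : R -> 'cV[R]_n) (t : R) :
  Ck 1 (basin f Omega) M -> basin f Omega (phi t) -> is_derive t 1 phi (f (phi t)) ->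
  is_derive t 1 (M \o phi) (orbital_derivative f M (phi t)).
Proof.
move=> cM bphi dphi; rewrite -dirder_orbital; last exact: (Ck_has_partials cM).
apply: is_derive_along dphi; last by move=> i; exact: (Ck_partials_continuous cM).
have := basin_open cf (periodic_orbit_nonempty perO) stableO bphi.
by apply: filterS => z bz; exact: (Ck_has_partials cM).
Qed.

Section trajectory.
Variables (x : 'cV[R]_n) (phi : R -> 'cV[R]_n).
Hypothesis sphi : forward_solution f x phi.
Hypothesis distphi : dist_set (phi t) Omega @[t --> +oo] --> (0 : R).

Let dphi : forall t : R, 0 <= t -> is_derive t 1 phi (f (phi t)).
Proof. by have [] := sphi. Qed.

Let bphi t : 0 <= t -> basin f Omega (phi t).
Proof. by move=> t0; exact: basin_orbit sphi distphi t t0. Qed.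

Lemma trajectory_neq0 t : 0 <= t -> f (phi t) != 0.
Proof. by move=> /bphi; exact: vector_field_neq0_basin. Qed.

Lemma transport (v w : R -> 'cV[R]_n) : transverse_solution f phi v ->
  transverse_solution f phi w ->
  forall t, 0 <= t -> (v t)^T *m N (phi t) *m w t = (v 0)^T *m N (phi 0) *m w 0.
Proof.
move=> dv dw t t0.
apply: (@derive0_constant _ _ _ (fun t => (v t)^T *m N (phi t) *m w t) 0 t t0) => s /andP[s0 _].
have bs := bphi s0.
have dN : is_derive s 1 (fun s => N (phi s))
    (- ((transverse_mx f (phi s))^T *m N (phi s) + N (phi s) *m transverse_mx f (phi s))).
  have := is_deriveB (is_derive_orbital cM1 bs (dphi s0)) (is_derive_orbital cM2 bs (dphi s0)).
  congr is_derive.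
  have := LM1 bs; have := LM2 bs; rewrite !LopE /N.
  move: (transverse_mx _ _) => A; rewrite mulmxBl mulmxBr.
  move: (orbital_derivative _ _ _) (orbital_derivative _ _ _) => o1 o2.
  move: (_ *m _) (_ *m _) (_ *m _) (_ *m _) (C _) => a1 a2 a3 a4 c.
  move=> /matrixP h2 /matrixP h1; apply/matrixP => i j.
  by move: (h1 i j) (h2 i j); rewrite !mxE; lra.
have := is_derive_mulmx (is_derive_mulmx (is_derive_trmx (dv s s0)) dN) (dw s s0).
congr is_derive; rewrite trmx_mul.
move: (transverse_mx _ _) (N _) (w s) ((v s)^T) => A Z b a.
rewrite mulmxN mulmxDr !mulmxA opprD addrA subrr sub0r mulNmx.
by rewrite addNr.
Qed.

(** Beyond [t0] the trajectory remains near [Omega], so every step of length [T] starts close to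
    some orbit point and halves the norm of [w]; orthogonality to [f] is preserved along the way. *)
Lemma transverse_decay : exists2 T : R, 0 < T & exists2 t0 : R, 0 <= t0 &
  forall w, transverse_solution f phi w -> (f x)^T *m w 0 = 0 ->
  forall k : nat, `|w (t0 + k%:R * T)| <= `|w t0| * 2^-1 ^+ k.
Proof.
have cO := periodic_orbit_compact perO; have O0 := periodic_orbit_nonempty perO.
have [d d0 [T T0 HT]] := transverse_contraction cf perO stableO.
(* Stated as a property of the starting point, the contraction holds near each point of [Omega],
   hence by compactness with one radius [e]. *)
pose P y := forall phi w, forward_solution f y phi ->
      (forall t : R, 0 <= t -> dist_set (phi t) Omega < d) ->
      (forall t, 0 <= t -> f (phi t) != 0) ->
      transverse_solution f phi w -> (f y)^T *m w 0 = 0 ->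
      `|w T| <= `|w 0| / 2.
have [|e e0 He] := @compact_tube R n Omega P cO.
  move=> p Op; apply/near_normP; have [eta eta0 H] := HT p Op.
  by exists eta => // y yp psi w spsi; exact: H.
have de0 : 0 < Num.min d e by rewrite lt_min d0.
have [t0 t00 Ht0] := dist_to0_eventually de0 distphi.
exists T => //; exists t0 => // w dw fw.
elim=> [|k IH]; first by rewrite mul0r addr0 expr0 mulr1.
set s := t0 + k%:R * T; have s0 : 0 <= s by rewrite addr_ge0// mulr_ge0// ltW.
have far t : 0 <= t -> dist_set (phi (s + t)) Omega < Num.min d e.
  by move=> t_ge0; apply: Ht0; rewrite /s -addrA lerDl addr_ge0// mulr_ge0// ltW.
have -> : t0 + k.+1%:R * T = s + T by rewrite /s -natr1 mulrDl mul1r addrA.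
have [p Op ps] := dist_set_lt_tube O0 (far 0 (lexx 0)).
have ps' : `|phi s - p| < e by rewrite addr0 in ps; rewrite (lt_le_trans ps)// ge_min lexx orbT.
have := He p (phi s) Op ps' (fun t => phi (s + t)) (fun t => w (s + t)).
rewrite addr0 => step.
apply: (@le_trans _ _ (`|w s| / 2)).
  apply: step.
  - exact: forward_solution_shift.
  - by move=> t /far h; rewrite (lt_le_trans h)// ge_min lexx.
  - by move=> t t_ge0; apply: trajectory_neq0; rewrite addr_ge0.
  - by move=> t t_ge0; apply: is_derive_shift_time; apply: dw; rewrite addr_ge0.
  - have := transverse_dot_constant cf dphi trajectory_neq0 dw s0.
    by have [-> _] := sphi; rewrite fw.
by rewrite exprSr mulrA ler_wpM2r.
Qed.

(** Split [w] into a solution orthogonal to [f], which decays, and a multiple of [f / |f|^2], which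
    is bounded near the compact orbit. *)
Lemma transverse_bounded (T t0 : R) w : 0 < T -> 0 <= t0 ->
  (forall w, transverse_solution f phi w -> (f x)^T *m w 0 = 0 ->
  forall k : nat, `|w (t0 + k%:R * T)| <= `|w t0| * 2^-1 ^+ k) ->
  transverse_solution f phi w ->
  exists2 B : R, 0 <= B & \forall k \near \oo, `|w (t0 + k%:R * T)| <= B.
Proof.
move=> T0 t00 decay dw.
have cO := periodic_orbit_compact perO; have O0 := periodic_orbit_nonempty perO.
have ch p : Omega p -> {for p, continuous (flow_covector f)}.
  by move=> Op; apply: flow_covector_continuous => //; exact: (vector_field_neq0_orbit cf perO).
have [d d0 [B B0 HB]] := compact_tube_bounded cO ch.
have [t1 t10 Ht1] := dist_to0_eventually d0 distphi.
pose a := ((f x)^T *m w 0) ord0 ord0.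
pose u t := w t - a *: flow_covector f (phi t).
have dh := flow_covector_transverse cf dphi trajectory_neq0.
have du : transverse_solution f phi u.
  move=> t t_ge0; rewrite /u mulmxBr.
  by apply: is_deriveB; [exact: dw|exact: (transverse_solutionZ a dh)].
have fu : (f x)^T *m u 0 = 0.
  have [phi0 _] := sphi; have := dot_flow_covector (trajectory_neq0 (lexx 0)).
  rewrite /u phi0 mulmxBr -(scalemxAr a) => ->.
  by rewrite [_ *m w 0]mx11_scalar -/a scale_scalar_mx mulr1 subrr.
exists (`|u t0| + `|a| * B); first by rewrite addr_ge0// mulr_ge0// ltW.
exists (Num.truncn (t1 / T)).+1 => // k /= kt.
set s := t0 + _.
have st1 : t1 <= s.
  have : t1 / T <= k%:R.
    apply: ltW; apply: (lt_le_trans (truncnS_gt _)); by rewrite ler_nat.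
  by rewrite ler_pdivrMr// => h; rewrite /s; apply: (le_trans h); rewrite lerDr.
have -> : w s = u s + a *: flow_covector f (phi s) by rewrite /u subrK.
apply: (le_trans (ler_normD _ _)); apply: lerD.
  apply: (le_trans (decay u du fu k)); rewrite ler_piMr//.
  by rewrite exprn_ile1 ?invr_ge0// invf_le1// ler1n.
rewrite normrZ ler_wpM2l//.
by have [p Op ps] := dist_set_lt_tube O0 (Ht1 s st1); exact: HB ps.
Qed.

(** Transport the product to the times [t0 + k T], where [v] and [N] are bounded and [w] is of order
    [2^-k]. *)
Lemma transverse_kernel (v0 w0 : 'cV[R]_n) : (f x)^T *m w0 = 0 ->
  v0^T *m N x *m w0 = 0.
Proof.
move=> fw0.
have cO := periodic_orbit_compact perO; have O0 := periodic_orbit_nonempty perO.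
have [T T0 [t0 t00 decay]] := transverse_decay.
have [v v0E dv] := transverse_solution_exists cf dphi trajectory_neq0 v0.
have [w w0E dw] := transverse_solution_exists cf dphi trajectory_neq0 w0.
have [B B0 HB] := transverse_bounded T0 t00 decay dv.
have cN p : Omega p -> {for p, continuous N}.
  move=> /(orbit_sub_basin perO) bp.
  have c1 := Ck_continuous cM1 bp; have c2 := Ck_continuous cM2 bp.
  exact: (cvgB c1 c2).
have [d d0 [D D0 HD]] := compact_tube_bounded cO cN.
have [t1 t10 Ht1] := dist_to0_eventually d0 distphi.
have fw : (f x)^T *m w 0 = 0 by rewrite w0E.
apply/eqP; rewrite -normr_le0; apply/ler_addgt0Pl => e e0; rewrite addr0.
pose E := n%:R ^+ 2 * (B * D * `|w t0|).
have [k0 Hk0] := geometric_small E e0.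
case: HB => k1 _ Hk1.
(* Three thresholds: the geometric bound is below [e], the bound on [v] is in force, and the
   trajectory lies in the tube where [N] is bounded. *)
pose k := (maxn k0 (maxn k1 (Num.truncn (t1 / T)).+1)).
have kk0 : (k0 <= k)%N by rewrite leq_maxl.
have kk1 : (k1 <= k)%N by rewrite /k leq_max leq_max leqnn orbT.
have kk2 : ((Num.truncn (t1 / T)).+1 <= k)%N by rewrite /k !leq_max leqnn !orbT.
set s := t0 + k%:R * T; have s0 : 0 <= s by rewrite addr_ge0// mulr_ge0// ltW.
have st1 : t1 <= s.
  have : t1 / T <= k%:R.
    apply: ltW; apply: (lt_le_trans (truncnS_gt _)); by rewrite ler_nat.
  by rewrite ler_pdivrMr// => h; rewrite /s; apply: (le_trans h); rewrite lerDr.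
have := transport dv dw s0; have [phi0 _] := sphi; rewrite phi0 v0E w0E => <-.
apply: (le_trans (bilinear_norm_le _ _ _)).
have [p Op ps] := dist_set_lt_tube O0 (Ht1 s st1).
apply: (@le_trans _ _ (E * 2^-1 ^+ k0)); last first.
  by apply: le_trans (ltW Hk0); exact: ler_norm.
rewrite /E -!mulrA ler_wpM2l ?exprn_ge0//.
rewrite ler_wpM2l// ler_pM ?mulr_ge0//; first exact: Hk1.
rewrite ler_pM//; first exact: (HD p _ Op ps).
apply: (le_trans (decay w dw fw k)); rewrite ler_wpM2l//.
by apply: ler_wiXn2l => //; rewrite ?invr_ge0// invf_le1// ler1n.
Qed.

End trajectory.

(** The coefficient [g] in [N = g f f^T]. *)
Let G x := ((flow_covector f x)^T *m N x *m flow_covector f x) ord0 ord0.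

Lemma flow_value_transport x phi : forward_solution f x phi ->
  dist_set (phi t) Omega @[t --> +oo] --> (0 : R) ->
  forall t, 0 <= t -> G (phi t) = G x.
Proof.
move=> sphi distphi t t0; have [phi0 dphi] := sphi.
have dh := flow_covector_transverse cf dphi (trajectory_neq0 sphi distphi).
by rewrite /G (transport sphi distphi dh dh t0) /= phi0.
Qed.

Lemma flow_value_constant x y : basin f Omega x -> basin f Omega y -> G x = G y.
Proof.
have cO := periodic_orbit_compact perO; have O0 := periodic_orbit_nonempty perO.
have [p [dp [T T0 [per OE Op _]]]] := periodic_orbit_param perO.
(* Late visits to each orbit point bring negative times [t] within reach of forward transport. *)
have Gp t : G (p t) = G (p 0).
  have sp : forward_solution f (p 0) p by split.
  have [u u0 <-] := per t 0.
  apply: (flow_value_transport sp) => //.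
  rewrite (_ : (fun t => _) = cst 0); first exact: cvg_cst.
  apply/funext => s /=; apply/eqP; rewrite eq_le dist_set_ge0 andbT.
  apply: (le_trans (dist_set_le _ (Op s))).
  by apply: (le_trans (enorm_le_norm _)); rewrite subrr normr0 mulr0.
have cG q : Omega q -> {for q, continuous G}.
  move=> Oq; have bq := orbit_sub_basin perO Oq.
  have c1 := Ck_continuous cM1 bq; have c2 := Ck_continuous cM2 bq.
  have cN : {for q, continuous N} by exact: (cvgB c1 c2).
  have ch := flow_covector_continuous cf (vector_field_neq0_orbit cf perO Oq).
  have := continuous_mulmx (continuous_mulmx (continuous_trmx ch) cN) ch.
  by move=> /continuous_mxP; exact.
suff H z : basin f Omega z -> G z = G (p 0) by move=> /H-> /H->.
move=> [phi sphi distphi].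
apply/eqP; rewrite -subr_eq0 -normr_le0; apply/ler_addgt0Pl => e e0; rewrite addr0.
have [|d d0 Hd] := @compact_tube R n Omega (fun y => `|G y - G (p 0)| <= e) cO.
  move=> q Oq; apply/near_normP.
  have -> : G (p 0) = G q by move: Oq; rewrite OE => -[t _ <-]; rewrite Gp.
  by have /continuous_atP := cG q Oq; exact.
have [t t0 Ht] := dist_to0_eventually d0 distphi.
have [q Oq ps] := dist_set_lt_tube O0 (Ht t (lexx t)).
by rewrite -(flow_value_transport sphi distphi t0); exact: Hd ps.
Qed.

(** Split both arguments of the bilinear form [N x] into a multiple of [f / |f|^2] and a part
    orthogonal to [f]. Orthogonal parts contribute nothing on the right, nor by symmetry on the
    left, and what remains is a multiple of [G x = G x0 = 0]. *)
Lemma solutions_eq x0 :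
  (forall x, basin f Omega x -> (N x)^T = N x) -> basin f Omega x0 ->
  (f x0)^T *m M1 x0 *m f x0 = (f x0)^T *m M2 x0 *m f x0 ->
  forall x, basin f Omega x -> M1 x = M2 x.
Proof.
move=> symN bx0 E0 x bx.
have Gx : (flow_covector f x)^T *m N x *m flow_covector f x = 0.
  apply/matrixP => i j; rewrite !ord1 -/(G x) (flow_value_constant bx bx0) /G.
  rewrite /flow_covector -scalemxAr mxE.
  have -> : ((enorm (f x0) ^+ 2)^-1 *: f x0)^T = (enorm (f x0) ^+ 2)^-1 *: (f x0)^T.
    by apply/matrixP => k l; rewrite !mxE.
  by rewrite -!scalemxAl /N mulmxBr mulmxBl E0 subrr scaler0 !mxE mulr0.
have [phi sphi distphi] := bx.
have ker (v w : 'cV[R]_n) : (f x)^T *m w = 0 -> v^T *m N x *m w = 0.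
  exact: (transverse_kernel sphi distphi).
have ker' (v w : 'cV[R]_n) : (f x)^T *m v = 0 -> v^T *m N x *m w = 0.
  move=> /(ker w) h; have <- : (w^T *m N x *m v)^T = v^T *m N x *m w.
    by rewrite trmx_mul [(w^T *m _)^T]trmx_mul symN// trmxK mulmxA.
  by rewrite h trmx0.
have dec (v : 'cV[R]_n) : exists a u, v = a *: flow_covector f x + u /\ (f x)^T *m u = 0.
  pose a := ((f x)^T *m v) ord0 ord0.
  exists a, (v - a *: flow_covector f x); split; first by rewrite addrC subrK.
  rewrite mulmxBr -(scalemxAr a) dot_flow_covector; last exact: (vector_field_neq0_basin cf perO).
  by rewrite [_ *m v]mx11_scalar -/a scale_scalar_mx mulr1 subrr.
have zero (v w : 'cV[R]_n) : v^T *m N x *m w = 0.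
  have [a [u [-> fu]]] := dec v; have [b [u' [-> fu']]] := dec w.
  rewrite [_ *m (_ + u')]mulmxDr (ker _ u' fu') addr0 -(scalemxAr b).
  have -> : (a *: flow_covector f x + u)^T = a *: (flow_covector f x)^T + u^T.
    by apply/matrixP => i j; rewrite !mxE.
  by rewrite !mulmxDl scalerDr [X in _ + b *: X](ker' u _ fu) scaler0 addr0 -!scalemxAl Gx !scaler0.
apply/eqP; rewrite -subr_eq0; apply/eqP/matrixP => i j.
have /matrixP/(_ ord0 ord0) := zero (delta_mx i ord0) (delta_mx j ord0).
by rewrite trmx_delta -rowE -colE !mxE.
Qed.

End uniqueness.

Lemma Ck_le (R : realType) (n : nat) (V : normedModType R) (k l : nat)
    (U : set 'cV[R]_n) (g : 'cV[R]_n -> V) : (k <= l)%N -> Ck l U g -> Ck k U g.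
Proof.
elim: k l g => [|k IH] [|l] g //= kl [cg dg]; first by split.
by split=> // i; have [d1 d2] := dg i; split=> //; exact: IH d2.
Qed.

Theorem theorem4p2 (R : realType) (n sigma : nat)
    (f : 'cV[R]_n -> 'cV[R]_n) (Omega : set 'cV[R]_n)
    (x0 : 'cV[R]_n) (c0 : R) (B C M1 M2 : 'cV[R]_n -> 'M[R]_n)
    (hsigma : (2 <= sigma)%N)
    (hf : Ck sigma [set: 'cV[R]_n] f)
    (hOmega : periodic_orbit f Omega)
    (hstable : exponentially_stable f Omega)
    (hx0 : basin f Omega x0)
    (hc0 : 0 < c0)
    (hB : Ck_sym sigma.-1 (basin f Omega) B)
    (hBpos : forall x, basin f Omega x -> posdefmx (B x))
    (hC : forall x, basin f Omega x ->
       C x = (proj_mx_at f x)^T *m B x *m proj_mx_at f x)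
    (hM1 : Ck_sym sigma.-1 (basin f Omega) M1)
    (hM1L : forall x, basin f Omega x -> Lop f M1 x = - C x)
    (hM1x0 : ((f x0)^T *m M1 x0 *m f x0) ord0 ord0 = c0 * enorm (f x0) ^+ 4)
    (hM2 : Ck_sym sigma.-1 (basin f Omega) M2)
    (hM2L : forall x, basin f Omega x -> Lop f M2 x = - C x)
    (hM2x0 : ((f x0)^T *m M2 x0 *m f x0) ord0 ord0 = c0 * enorm (f x0) ^+ 4) :
  forall x, basin f Omega x -> M1 x = M2 x.
Proof.
have sigma1 : (1 <= sigma.-1)%N by rewrite -ltnS (ltn_predK hsigma).
have [cM1 sM1] := hM1; have [cM2 sM2] := hM2.
apply: (@solutions_eq R n f Omega C M1 M2 (Ck_le hsigma hf) hOmega hstable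
  (Ck_le sigma1 cM1) (Ck_le sigma1 cM2) hM1L hM2L x0) => //.
  have symT (A : 'M[R]_n) : A \is symmetricmx -> A^T = A.
    by move=> /is_hermitianmxP; rewrite expr0 scale1r map_mx_id.
  move=> x bx; apply/matrixP => i j.
  have /matrixP/(_ i j) := symT _ (sM1 x bx); have /matrixP/(_ i j) := symT _ (sM2 x bx).
  by rewrite !mxE => -> ->.
by apply/matrixP => i j; rewrite !ord1 hM1x0 hM2x0.
Qed.
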